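(* Let $n \ge 1$, let $d_1,\ldots,d_n$ be positive integers, and let $v_1, v_2, \ldots, v_n$ be non-zero vectors with $v_k \in \mathbb{R}^{d_k}$ for each $k$. Let $\alpha_1,\ldots,\alpha_n \in \mathbb{R}$ and let $1 \le a < b \le \infty$. Suppose that $$\alpha_1\|v_1\|_p + \alpha_2\|v_2\|_p + \cdots + \alpha_n\|v_n\|_p = 0 \quad \text{for all } p \in [a,b].$$ Call two of the vectors $v_j$ and $v_k$ equivalent if they differ by adding zeros, permuting or negating coordinates, and rescaling (as made precise in the context). Then for every equivalence class $C \subseteq \{1,\ldots,n\}$ of indices under the relation ''$v_j$ is equivalent to $v_k$'', the terms of the equation in that class already sum to zero, i.e. $$\sum_{k \in C} \alpha_k \|v_k\|_p = 0 \quad \text{for all } p \in [a,b].$$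
   Context: For $v = (x_1,\ldots,x_d) \in \mathbb{R}^d$, the $p$-norm is $\|v\|_p = \left(\sum_{i=1}^d |x_i|^p\right)^{1/p}$ for $1 \le p < \infty$, and $\|v\|_\infty = \max_i |x_i|$. If $b = \infty$, then $[a,b]$ includes the value $p = \infty$. Equivalence of vectors (possibly of different dimensions): two non-zero vectors $v \in \mathbb{R}^d$ and $w \in \mathbb{R}^{e}$ are equivalent if one can be obtained from the other by a finite sequence of the following operations: appending or deleting coordinates equal to zero, permuting coordinates, changing the sign of some coordinates, and multiplying the whole vector by a non-zero real scalar. Equivalently, there is a real $c > 0$ such that the multiset of absolute values of the non-zero coordinates of $v$ equals $c$ times the multiset of absolute values of the non-zero coordinates of $w$. *)

(* Defs.v *)
From HB Require Import structures.
From mathcomp Require Import all_boot all_order all_algebra perm.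
From mathcomp Require Import all_classical all_reals all_analysis.

Set Implicit Arguments.
Unset Strict Implicit.
Unset Printing Implicit Defensive.

Import Order.TTheory GRing.Theory Num.Theory.
Local Open Scope ring_scope.

(* The value at -oo is junk: only exponents p >= 1 are meaningful. *)
Definition pnorm (R : realType) (d : nat) (p : \bar R) (v : 'rV[R]_d) : R :=
  match p with
  | EFin r => (\sum_i `|v 0 i| `^ r) `^ r^-1
  | +oo%E => \big[Num.max/0]_i `|v 0 i|
  | -oo%E => 0
  end.

(* The constructors other than [ve_refl] and [ve_trans] are the elementary
   operations, each of which can be undone by operations of the list, so that
   the relation is symmetric. *)
Inductive vec_equiv (R : realType) :
    forall d e : nat, 'rV[R]_d -> 'rV[R]_e -> Prop :=
| ve_refl d (v : 'rV[R]_d) : vec_equiv v v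
| ve_trans d e f (u : 'rV[R]_d) (v : 'rV[R]_e) (w : 'rV[R]_f) :
    vec_equiv u v -> vec_equiv v w -> vec_equiv u w
| ve_append d (v : 'rV[R]_d) : vec_equiv v (row_mx v (0 : 'rV[R]_1))
| ve_delete d (v : 'rV[R]_d) (i : 'I_d) :
    v 0 i = 0 -> vec_equiv v (col' i v)
| ve_perm d (v : 'rV[R]_d) (s : 'S_d) : vec_equiv v (col_perm s v)
| ve_sign d (v : 'rV[R]_d) (eps : 'I_d -> bool) :
    vec_equiv v (\row_i ((-1) ^+ eps i * v 0 i))
| ve_scale d (v : 'rV[R]_d) (c : R) : c != 0 -> vec_equiv v (c *: v).

Definition vec_equivb (R : realType) (n : nat) (d : 'I_n -> nat)
    (v : forall k, 'rV[R]_(d k)) : rel 'I_n :=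
  fun j k => `[< vec_equiv (v j) (v k) >].

(* Main.v *)
Require Import Defs.
From HB Require Import structures.
From mathcomp Require Import all_boot all_order all_algebra perm.
From mathcomp Require Import all_classical all_reals all_analysis.
From mathcomp Require Import ring lra zify.

Set Implicit Arguments.
Unset Strict Implicit.
Unset Printing Implicit Defensive.

Import Order.TTheory GRing.Theory Num.Theory.
Import numFieldNormedType.Exports.
Local Open Scope ring_scope.

(**
After scaling, the vector [v k] has maximum norm [lam k] and its nonzero
entries have absolute values [lam k * exp (- r)], where [r] runs over a
multiset [rates (v k)] of nonnegative reals that contains [0]. Two vectors are
equivalent exactly when these multisets agree ([vec_equiv_rates]), and [|v k|_p
= lam k * F_k(p) ^ (1 / p)] with [F_k(p) = \sum_r exp (- r p)]
([pnorm_powsum]). So it must be shown that a relation [\sum_k b k * F_k(p) ^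
(1 / p) = 0] on an interval forces the sum of the [b k] over each class to
vanish; this also settles the exponent infinity.

The functions involved are real-analytic in [p > 0], being obtained from
exponentials by sums, products, inverses, logarithms and exponentials, so that
the relation persists for all large [p] ([analytic_identity]).

Let [p] tend to infinity and put [L_k = ln F_k], which is bounded. If the
relation were [\sum_k b k * exp (t L_k(p)) = 0] for independent [t] and [p],
differentiating in [t] at [0] would annihilate all the power sums [phi_i =
\sum_k b k * L_k ^ i]. Here [t = 1 / p], but the two variables can be
decoupled, because the [phi_i] have expansions in decaying exponentials [exp (-
l p)] with constant coefficients: if [exp (- l p)] is the leading one among
[phi_0], ..., [phi_(n-1)], with coefficients [c_i], then dividing by it gives
[\sum_(i < n) c_i / i! * p ^ (- i) = O (p ^ (- n))], so all [c_i] vanish. The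
error term is of this order because the [phi_j] with [j >= n] are controlled by
the first [n] of them through a linear recurrence ([power_sum_growth],
[exp_sum_approx]). Hence the first [n] power sums decay faster than every
exponential ([power_sum_flat]).

On the other hand, two functions [F_j] and [F_k] with different multisets of
rates differ by an exponential sum that is not identically zero, so [L_j - L_k]
does not decay faster than some exponential. Interpolating at the [L_k] the
indicator of the class of [j], up to the factor [\prod_k (L_j - L_k)], then
shows that the sum of the [b k] over this class is zero ([powsum_classes]).
*)

(** * Real-analytic functions on the positive half-line *)

Lemma is_derive_mul (R : realType) (f g : R -> R) (x df dg : R) :
  is_derive x 1 f df -> is_derive x 1 g dg ->
  is_derive x 1 (fun y => f y * g y) (df * g x + f x * dg).
Proof.
move=> hf hg; apply: (is_derive_eq (is_deriveM hf hg)).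
by rewrite /GRing.scale /= addrC mulrC (mulrC df).
Qed.

Lemma is_derive_add (R : realType) (f g : R -> R) (x df dg : R) :
  is_derive x 1 f df -> is_derive x 1 g dg ->
  is_derive x 1 (fun y => f y + g y) (df + dg).
Proof. by move=> hf hg; exact: (is_deriveD hf hg). Qed.

Lemma is_derive_sumf (R : realType) n (h : 'I_n -> R -> R) (x : R) dh :
  (forall i, is_derive x 1 (h i) (dh i)) ->
  is_derive x 1 (fun y => \sum_i h i y) (\sum_i dh i).
Proof.
move=> H; have := is_derive_sum H.
by congr (is_derive _ _ _ _); apply/funext => y; rewrite fct_sumE.
Qed.

Lemma is_derive_ext_pos (R : realType) (f g : R -> R) (x df : R) :
  0 < x -> (forall y, 0 < y -> f y = g y) ->
  is_derive x 1 f df -> is_derive x 1 g df.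
Proof.
move=> x0 fg; apply: near_eq_is_derive; near=> y; apply: fg; near: y.
exact: lt_nbhsr.
Unshelve. all: by end_near. Qed.

Lemma derivable_bounded (R : realType) (f : R -> R) (u w : R) :
  (forall x, 0 < x -> derivable f x 1) -> 0 < u ->
  exists2 M, 1 <= M & forall x, u <= x <= w -> `|f x| <= M.
Proof.
move=> df u0; have [uw|wu] := leP u w; last first.
  exists 1 => // x /andP[ux xw].
  by have := lt_le_trans wu (le_trans ux xw); rewrite ltxx.
have cf : {within `[u, w], continuous (fun x => `|f x|)}%classic.
  have := @derivable_within_continuous _ _ f `[u, w].
  move=> H; have {}H : {within `[u, w], continuous f}%classic.
    by apply: H => x; rewrite in_itv /= => /andP[ux _]; apply/df/(lt_le_trans u0).
  move=> x; apply: continuous_comp; first exact: H.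
  exact: norm_continuous.
have [c _ Hc] := EVT_max uw cf.
exists (1 + `|f c|); first by rewrite lerDl.
move=> x xuw; apply: (le_trans (Hc x _)); first by rewrite in_itv.
by rewrite lerDr.
Qed.

(** Builds the sequences of functions that satisfy the power series recursions
below. *)
Lemma course_of_values (T : Type) (step : seq T -> T) :
  exists b : nat -> T, forall n, b n = step (mkseq b n).
Proof.
pose L := fix L n := if n is m.+1 then rcons (L m) (step (L m)) else [::].
exists (fun n => step (L n)) => n; congr step.
elim: n => // n IHn; rewrite /mkseq -[n.+1]addn1 iotaD map_cat cats1 add0n.
by rewrite addn1 /= -/(mkseq _ _) -IHn.
Qed.

(** The sequence [c] is that of the Taylor coefficients [f^(n)(x) / n!] of
[f = c 0], as functions of the centre [x]. A bound [M ^ (n + 1)] that is uniform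
on compact sets is what makes the Taylor series converge to [f] with a radius
bounded below; this is real analyticity on the positive half-line, phrased
without power series. *)
Definition jet (R : realType) (c : nat -> R -> R) : Prop :=
  (forall n (x : R), 0 < x -> is_derive x 1 (c n) (n.+1%:R * c n.+1 x)) /\
  (forall u w : R, 0 < u ->
     exists2 M, 1 <= M & forall n (x : R), u <= x <= w -> `|c n x| <= M ^+ n.+1).

Definition analytic_pos (R : realType) (f : R -> R) : Prop :=
  exists2 c, jet c & forall x : R, 0 < x -> c 0%N x = f x.

Lemma analytic_ext (R : realType) (f g : R -> R) :
  (forall x, 0 < x -> f x = g x) -> analytic_pos f -> analytic_pos g.
Proof. by move=> fg [c jc cf]; exists c => // x x0; rewrite cf ?fg. Qed.

Lemma analytic_derive (R : realType) (f : R -> R) :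
  analytic_pos f -> exists2 g, analytic_pos g &
    forall x : R, 0 < x -> is_derive x 1 f (g x).
Proof.
move=> [c [dc bc] cf]; exists (c 1%N); last first.
  move=> x x0; apply: (is_derive_ext_pos x0 cf).
  by have := dc 0%N x x0; rewrite mul1r.
exists (fun n x => n.+1%:R * c n.+1 x); last by move=> x _; rewrite mul1r.
split=> [n x x0|u w u0].
  apply: (is_derive_eq (is_derive_mul (is_derive_cst _ _ _) (dc n.+1 x x0))).
  by rewrite mul0r add0r.
have [M M1 HM] := bc u w u0; exists (2 * M ^+ 2).
  by rewrite mulr_ege1 ?exprn_ege1 // ler1n.
move=> n x xuw; rewrite normrM exprMn -exprM ger0_norm //.
apply: ler_pM => //; first by rewrite -natrX ler_nat; exact: ltnW (ltn_expl _ _).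
by apply: (le_trans (HM _ _ xuw)); apply: ler_weXn2l => //; lia.
Qed.

Lemma analytic_cst (R : realType) (k : R) : analytic_pos (fun=> k).
Proof.
exists (fun n _ => if n is 0 then k else 0) => //; split=> [n x x0|u w u0].
  by rewrite mulr0; case: n => [|n]; exact: is_derive_cst.
exists (1 + `|k|) => [|[|n] x _]; first by rewrite lerDl.
  by rewrite expr1 lerDr.
by rewrite normr0 exprn_ge0 // addr_ge0.
Qed.

Lemma analytic_id (R : realType) : analytic_pos (@id R).
Proof.
exists (fun n x => if n is n'.+1 then (n' == 0%N)%:R else x) => //.
split=> [[|n] x x0|u w u0].
- by rewrite mul1r; exact: is_derive_id.
- by rewrite mulr0; exact: is_derive_cst.
exists (1 + `|w|) => [|[|n] x /andP[ux xw]]; first by rewrite lerDl.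
  have x0 := lt_le_trans u0 ux.
  rewrite expr1 gtr0_norm // (le_trans xw) // (le_trans (ler_norm _)) //.
  by rewrite lerDr.
apply: (@le_trans _ _ 1); first by rewrite normr_nat; case: eqP.
by rewrite exprn_ege1 // lerDl.
Qed.

Lemma analytic_add (R : realType) (f g : R -> R) :
  analytic_pos f -> analytic_pos g -> analytic_pos (fun x => f x + g x).
Proof.
move=> [a [da ba] af] [b [db bb] bg].
exists (fun n x => a n x + b n x); last by move=> x x0; rewrite af ?bg.
split=> [n x x0|u w u0].
  by rewrite mulrDr; apply: is_derive_add; [exact: da|exact: db].
have [M M1 HM] := ba u w u0; have [N N1 HN] := bb u w u0.
exists (M + N); first by rewrite (le_trans M1) // lerDl (le_trans _ N1).
move=> n x xuw; rewrite (le_trans (ler_normD _ _)) //.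
rewrite (le_trans (lerD (HM n x xuw) (HN n x xuw))) //.
have M0 : 0 <= M by exact: le_trans M1. have N0 : 0 <= N by exact: le_trans N1.
elim: n => [|n IHn]; first by rewrite !expr1.
rewrite 2!(exprSr _ n.+1) (exprSr (M + N)) mulrDr.
have := exprn_ge0 n.+1 M0; have := exprn_ge0 n.+1 N0; nra.
Qed.

(** The derivative of a Cauchy product of two jets is again a Cauchy product, up
to the factor [n + 1] that the definition of a jet requires. *)
Lemma cauchy_derive (R : comRingType) (a b : nat -> R) n :
  \sum_(i < n.+1) (i.+1%:R * a i.+1 * b (n - i)%N +
                   a i * ((n - i).+1%:R * b (n - i).+1)) =
  n.+1%:R * \sum_(i < n.+2) a i * b (n.+1 - i)%N.
Proof.
rewrite mulr_sumr (eq_bigr (fun i : 'I_n.+2 =>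
  i%:R * a i * b (n.+1 - i)%N + a i * ((n.+1 - i)%:R * b (n.+1 - i)%N))); last first.
  move=> i _; have /natrB -> : (i <= n.+1)%N by rewrite -ltnS.
  by ring.
rewrite !big_split /=; congr (_ + _).
  by rewrite [RHS]big_ord_recl /= mulr0n !mul0r add0r.
rewrite [RHS]big_ord_recr /= subnn mulr0n mul0r mulr0 addr0.
by apply: eq_bigr => i _; rewrite subSn ?leq_ord.
Qed.

Lemma analytic_mul (R : realType) (f g : R -> R) :
  analytic_pos f -> analytic_pos g -> analytic_pos (fun x => f x * g x).
Proof.
move=> [a [da ba] af] [b [db bb] bg].
exists (fun n x => \sum_(i < n.+1) a i x * b (n - i)%N x); last first.
  by move=> x x0; rewrite big_ord1 af ?bg.
split=> [n x x0|u w u0].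
  rewrite -(cauchy_derive (fun i => a i x) (fun i => b i x)).
  by apply: is_derive_sumf => i; apply: is_derive_mul; [exact: da|exact: db].
have [M M1 HM] := ba u w u0; have [N N1 HN] := bb u w u0.
have M0 : 0 <= M by exact: le_trans M1. have N0 : 0 <= N by exact: le_trans N1.
have MN1 : 1 <= M * N by rewrite mulr_ege1.
exists (2 * (M * N) ^+ 2); first by rewrite mulr_ege1 ?exprn_ege1 // ler1n.
move=> n x xuw; rewrite (le_trans (ler_norm_sum _ _ _)) //.
apply: (@le_trans _ _ (\sum_(i < n.+1) (M * N) ^+ n.+2)).
  apply: ler_sum => i _; have /ltnSE/subnKC ni := ltn_ord i.
  rewrite normrM (le_trans (ler_pM _ _ (HM _ _ xuw) (HN _ _ xuw))) //.
  rewrite exprMn; apply: ler_pM; rewrite ?exprn_ge0 //;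
  by apply: ler_weXn2l => //; lia.
rewrite sumr_const card_ord -[leLHS]mulr_natl [leRHS]exprMn -exprM; apply: ler_pM => //.
- by rewrite exprn_ge0 // (le_trans _ MN1).
- by rewrite -natrX ler_nat; exact: ltnW (ltn_expl _ _).
- by apply: ler_weXn2l => //; lia.
Qed.

Lemma analytic_primitive (R : realType) (f g : R -> R) :
  analytic_pos g -> (forall x : R, 0 < x -> is_derive x 1 f (g x)) ->
  analytic_pos f.
Proof.
move=> [c [dc bc] cg] df.
exists (fun n x => if n is n'.+1 then n'.+1%:R^-1 * c n' x else f x) => //.
split=> [[|n] x x0|u w u0].
- by rewrite mul1r invr1 mul1r cg //; exact: df.
- apply: (is_derive_eq (is_derive_mul (is_derive_cst _ _ _) (dc n x x0))).
  by rewrite mul0r add0r mulVKf ?pnatr_eq0 // mulKf ?pnatr_eq0.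
have [M M1 HM] := bc u w u0.
have df' (x : R) : 0 < x -> derivable f x 1 by move=> x0; case: (df x x0).
have [N N1 HN] := derivable_bounded w df' u0.
have M0 : 0 <= M by exact: le_trans M1. have N0 : 0 <= N by exact: le_trans N1.
exists (M * N) => [|[|n] x xuw]; first by rewrite mulr_ege1.
  by rewrite expr1 (le_trans (HN x xuw)) // ler_peMl.
rewrite normrM normfV normr_nat (@le_trans _ _ (M ^+ n.+1)) //.
  rewrite (le_trans _ (HM n x xuw)) // ler_piMl // invf_le1 ?ler1n //.
apply: (@le_trans _ _ (M ^+ n.+2)); first by apply: ler_weXn2l => //; lia.
by rewrite exprMn ler_peMr ?exprn_ege1 ?exprn_ge0.
Qed.

(** The Taylor coefficients of a solution of [y' = h y] satisfy
[(n + 1) y_(n+1) = \sum_i h_i y_(n-i)]: the [n + 1] terms of the sum are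
compensated by the factor [n + 1], so that a geometric bound on [h]
propagates. *)
Lemma analytic_linear_ode (R : realType) (f h : R -> R) :
  analytic_pos h -> (forall x : R, 0 < x -> is_derive x 1 f (h x * f x)) ->
  analytic_pos f.
Proof.
move=> [a [da ba] ah] df.
have [y Hy] := course_of_values (fun s : seq (R -> R) =>
  if s is [::] then f else fun x =>
  (size s)%:R^-1 * \sum_(i < size s) a i x * nth f s ((size s).-1 - i)%N x).
have y0 : y 0%N = f by rewrite Hy.
have yS n : y n.+1 = fun x => n.+1%:R^-1 * \sum_(i < n.+1) a i x * y (n - i)%N x.
  rewrite Hy; have : size (mkseq y n.+1) = n.+1 by rewrite size_mkseq.
  case E : (mkseq y n.+1) => [//|r s] sE; rewrite -E in sE *; rewrite sE.
  apply/funext => x; congr (_ * _); apply: eq_bigr => i _.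
  by rewrite nth_mkseq // ltnS leq_subr.
clear Hy; have dy n : forall m, (m <= n)%N -> forall x : R, 0 < x ->
    is_derive x 1 (y m) (m.+1%:R * y m.+1 x).
  elim: n => [|n IHn] m; first rewrite leqn0 => /eqP -> x x0.
    rewrite y0 yS invr1 !mul1r big_ord1 subnn y0 ah //; exact: df.
  rewrite leq_eqVlt => /orP[/eqP ->{m}|/IHn//] x x0.
  rewrite yS [y n.+2]yS /= mulrA divff ?pnatr_eq0 // mul1r.
  have -> : \sum_(i < n.+2) a i x * y (n.+1 - i)%N x = n.+1%:R^-1 *
      \sum_(i < n.+1) (i.+1%:R * a i.+1 x * y (n - i)%N x +
                       a i x * ((n - i).+1%:R * y (n - i).+1 x)).
    rewrite (cauchy_derive (fun i => a i x) (fun i => y i x)).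
    by rewrite mulKf ?pnatr_eq0.
  set S := \sum_(i < n.+1) _.
  have dS : is_derive x 1 (fun z => \sum_(i < n.+1) a i z * y (n - i)%N z) S.
    apply: is_derive_sumf => i; apply: is_derive_mul; first exact: da.
    by apply: IHn => //; exact: leq_subr.
  apply: (is_derive_eq (is_derive_mul (is_derive_cst _ _ _) dS)).
  by rewrite mul0r add0r.
exists y => [|x x0]; last by rewrite y0.
split=> [n x x0|u w u0]; first exact: (dy n).
have [M M1 HM] := ba u w u0.
have df' (x : R) : 0 < x -> derivable f x 1 by move=> x0; case: (df x x0).
have [N N1 HN] := derivable_bounded w df' u0.
have M0 : 0 <= M by exact: le_trans M1. have N0 : 0 <= N by exact: le_trans N1.
have MN1 : 1 <= M * N by rewrite mulr_ege1.
exists (M * N) => // n x xuw.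
have [m] := ubnP n; elim: m n => // m IHm [_|n]; first rewrite y0 expr1.
  by rewrite (le_trans (HN x xuw)) // ler_peMl.
rewrite ltnS => nm.
rewrite yS normrM normfV normr_nat ler_pdivrMl ?ltr0n //.
rewrite (le_trans (ler_norm_sum _ _ _)) // mulr_natl.
rewrite -[X in _ *+ X]card_ord -sumr_const ler_sum // => i _.
have ni := ltn_ord i; rewrite ltnS in ni.
rewrite normrM (le_trans (ler_pM _ _ (HM _ _ xuw) (IHm (n - i)%N _))) //.
  by rewrite (leq_ltn_trans _ nm) ?leq_subr.
apply: (@le_trans _ _ ((M * N) ^+ i.+1 * (M * N) ^+ (n - i).+1)).
  rewrite ler_wpM2r ?exprn_ge0 ?(le_trans _ MN1) // lerXn2r ?nnegrE //.
    by rewrite (le_trans _ MN1).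
  by rewrite ler_peMr.
by rewrite -exprD (_ : (i.+1 + (n - i).+1)%N = n.+2) //; lia.
Qed.

(** The coefficients of [1 / f] solve
[a_0 y_(n+1) = - \sum_i a_(i+1) y_(n-i)]. *)
Lemma analytic_inv (R : realType) (f : R -> R) :
  (forall x : R, 0 < x -> f x != 0) ->
  analytic_pos f -> analytic_pos (fun x => (f x)^-1).
Proof.
move=> f0 [a [da ba] af].
have [y Hy] := course_of_values (fun s : seq (R -> R) =>
  if s is [::] then fun x => (a 0%N x)^-1 else fun x =>
  - (a 0%N x)^-1 * \sum_(i < size s) a i.+1 x * nth f s ((size s).-1 - i)%N x).
have y0 : y 0%N = fun x => (a 0%N x)^-1 by rewrite Hy.
have yS n : y n.+1 = fun x => - (a 0%N x)^-1 *
    \sum_(i < n.+1) a i.+1 x * y (n - i)%N x.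
  rewrite Hy; have : size (mkseq y n.+1) = n.+1 by rewrite size_mkseq.
  case E : (mkseq y n.+1) => [//|r s] sE; rewrite -E in sE *; rewrite sE.
  apply/funext => x; congr (_ * _); apply: eq_bigr => i _.
  by rewrite nth_mkseq // ltnS leq_subr.
have a0 (x : R) : 0 < x -> a 0%N x != 0 by move=> x0; rewrite af ?f0.
have dinv (x : R) : 0 < x ->
    is_derive x 1 (fun x => (a 0%N x)^-1) (- (a 0%N x)^-1 ^+ 2 * a 1%N x).
  move=> x0; apply: (is_derive_eq (is_deriveV (a0 x x0) (da 0%N x x0))).
  by rewrite /GRing.scale /= mul1r exprVn.
clear Hy; have dy n : forall m, (m <= n)%N -> forall x : R, 0 < x ->
    is_derive x 1 (y m) (m.+1%:R * y m.+1 x).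
  elim: n => [|n IHn] m; first rewrite leqn0 => /eqP -> x x0.
    rewrite y0 yS mul1r big_ord1 subnn y0; apply: (is_derive_eq (dinv x x0)).
    by ring.
  rewrite leq_eqVlt => /orP[/eqP ->{m}|/IHn//] x x0.
  have dS : is_derive x 1 (fun z => \sum_(i < n.+1) a i.+1 z * y (n - i)%N z)
      (\sum_(i < n.+1) (i.+2%:R * a i.+2 x * y (n - i)%N x +
                        a i.+1 x * ((n - i).+1%:R * y (n - i).+1 x))).
    apply: is_derive_sumf => i; apply: is_derive_mul; first exact: da.
    by apply: IHn => //; exact: leq_subr.
  rewrite [y n.+1]yS.
  apply: (is_derive_eq (is_derive_mul (is_deriveN (dinv x x0)) dS)).
  have := cauchy_derive (fun i => a i.+1 x) (fun i => y i x) n.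
  set T := \sum_(i < n.+2) _; rewrite [y n.+2]yS -/T => ET.
  have E1 : \sum_(i < n.+1) a i.+1 x * y (n - i)%N x = - a 0%N x * y n.+1 x.
    by rewrite yS !mulNr mulrN opprK mulVKf ?a0.
  have ET' : T = a 1%N x * y n.+1 x + \sum_(i < n.+1) a i.+2 x * y (n - i)%N x.
    by rewrite /T big_ord_recl.
  rewrite E1 (eq_bigr (fun i : 'I_n.+1 => a i.+2 x * y (n - i)%N x +
    (i.+1%:R * a i.+2 x * y (n - i)%N x +
                   a i.+1 x * ((n - i).+1%:R * y (n - i).+1 x)))); last first.
    by move=> i _; rewrite -[i.+2%:R]natr1; ring.
  rewrite big_split /= ET.
  have -> : \sum_(i < n.+1) a i.+2 x * y (n - i)%N x = T - a 1%N x * y n.+1 x.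
    by rewrite ET' addrC addKr.
  rewrite -[n.+2%:R]natr1 -/T; move: (a0 x x0) => ax0.
  rewrite (_ : (- (fun z => (a 0%N z)^-1)) x = - (a 0%N x)^-1) //.
  by field.
exists y => [|x x0]; last by rewrite y0 af.
split=> [n x x0|u w u0]; first exact: (dy n).
have [M M1 HM] := ba u w u0.
have df' (x : R) : 0 < x -> derivable (fun x => (a 0%N x)^-1) x 1.
  by move=> x0; case: (dinv x x0).
have [N N1 HN] := derivable_bounded w df' u0.
have M0 : 0 <= M by exact: le_trans M1. have N0 : 0 <= N by exact: le_trans N1.
pose K := 2 * (N * M ^+ 2).
have NM1 : 1 <= N * M ^+ 2 by rewrite mulr_ege1 ?exprn_ege1.
have K1 : 1 <= K by rewrite mulr_ege1 ?ler1n.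
have K0 : 0 <= K by exact: le_trans K1.
exists K => // n x xuw.
have [m] := ubnP n; elim: m n => // m IHm [_|n].
  rewrite y0 expr1 (le_trans (HN x xuw)) // /K mulrCA ler_peMr //.
  by rewrite mulr_ege1 ?exprn_ege1 // ler1n.
rewrite ltnS => nm; rewrite yS normrM normrN.
(* With [K = 2 N M ^ 2], the term of index [i] of the recursion gains a factor
   [2 ^ - (i + 1)]. *)
have half k : \sum_(i < k) (2^-1 : R) ^+ i.+1 = 1 - 2^-1 ^+ k.
  elim: k => [|k IHk]; first by rewrite big_ord0 expr0 subrr.
  by rewrite big_ord_recr /= IHk exprS; lra.
apply: (@le_trans _ _ (\sum_(i < n.+1) K ^+ n.+2 * 2^-1 ^+ i.+1)); last first.
  by rewrite -mulr_sumr half ler_piMr ?exprn_ge0 // gerBl exprn_ge0.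
apply: (le_trans (ler_pM _ _ (HN x xuw) (ler_norm_sum _ _ _))) => //.
rewrite mulr_sumr ler_sum // => i _.
have ni := ltn_ord i; rewrite ltnS in ni.
rewrite normrM.
apply: (@le_trans _ _ (N * (M ^+ i.+2 * K ^+ (n - i).+1))).
  rewrite ler_wpM2l // ler_pM ?HM //; apply: IHm.
  by rewrite (leq_ltn_trans _ nm) ?leq_subr.
have -> : n.+2 = ((n - i).+1 + i.+1)%N by lia.
rewrite exprD -mulrA -exprMn [K * _]mulrC mulKf // mulrA [leRHS]mulrC.
rewrite ler_wpM2r ?exprn_ge0 // exprMn -exprM.
by apply: ler_pM; rewrite ?exprn_ge0 // ?ler_eXnr // ler_weXn2l //; lia.
Qed.

Lemma bin_leq_exp2 m k : ('C(m, k) <= 2 ^ m)%N.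
Proof.
elim: m k => [|m IHm] [|k] //; first by rewrite bin0 expn_gt0.
by rewrite binS expnS mul2n -addnn leq_add.
Qed.

Lemma analytic_expR (R : realType) (g : R -> R) :
  analytic_pos g -> analytic_pos (fun x => expR (g x)).
Proof.
move=> /[dup] gA /analytic_derive[h hA dg]; apply: analytic_linear_ode hA _.
move=> x x0; apply: (is_derive_eq (is_derive1_comp (is_derive_expR _) (dg x x0))).
by rewrite mulrC.
Qed.

Lemma analytic_ln (R : realType) (g : R -> R) :
  (forall x : R, 0 < x -> 0 < g x) ->
  analytic_pos g -> analytic_pos (fun x => ln (g x)).
Proof.
move=> g0 /[dup] gA /analytic_derive[h hA dg].
apply: (@analytic_primitive _ _ (fun x => (g x)^-1 * h x)).
  apply: analytic_mul => //; apply: analytic_inv => // x x0.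
  by rewrite gt_eqF ?g0.
by move=> x x0; apply: is_derive1_comp; [exact: is_derive1_ln (g0 x x0)|exact: dg].
Qed.

Lemma analytic_sum (R : realType) (I : Type) (s : seq I) (F : I -> R -> R) :
  (forall i, analytic_pos (F i)) ->
  analytic_pos (fun x => \sum_(i <- s) F i x).
Proof.
move=> FA; elim: s => [|i s IHs].
  by apply: (analytic_ext _ (analytic_cst 0)) => x _; rewrite big_nil.
by apply: (analytic_ext _ (analytic_add (FA i) IHs)) => x _; rewrite big_cons.
Qed.

Lemma derive_le_ndecr (R : realType) (f df : R -> R) (u x : R) :
  0 < u -> u <= x ->
  (forall y : R, 0 < y -> is_derive y 1 f (df y)) ->
  (forall y, u <= y <= x -> 0 <= df y) -> f u <= f x.
Proof.
move=> u0 ux dfE df0; rewrite -subr_ge0.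
have [||c] := @MVT_segment _ f df u x ux.
- by move=> y; rewrite in_itv /= => /andP[uy _]; apply/dfE/(lt_trans u0).
- apply: derivable_within_continuous => y; rewrite in_itv /= => /andP[uy _].
  by case: (dfE y (lt_le_trans u0 uy)).
by rewrite in_itv /= => cux ->; rewrite mulr_ge0 ?df0 // subr_ge0.
Qed.

(** Each order is obtained from the previous one by integrating the bound on
[c (n + 1)]; stating it for all [n] at once lets the induction on [k] go
through. *)
Lemma jet_taylor (R : realType) (c : nat -> R -> R) (M u e : R) :
  jet c -> 0 < u -> 0 <= M ->
  (forall n x, u <= x <= e -> `|c n x| <= M ^+ n.+1) ->
  (forall n, c n u = 0) ->
  forall k n x, u <= x <= e ->
    `|c n x| <= 'C(n + k, k)%:R * M ^+ (n + k).+1 * (x - u) ^+ k.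
Proof.
move=> [dc _] u0 M0 cM cu0; elim=> [|k IHk] n x uxe.
  by rewrite bin0 mul1r expr0 mulr1 addn0 cM.
have /andP[ux xe] := uxe.
set A := 'C(n + k.+1, k.+1)%:R * M ^+ (n + k.+1).+1.
(* [A (z - u) ^ (k + 1) + s * c n z], for [s] equal to [1] and [- 1], vanishes
   at [u] and has a nonnegative derivative. *)
have dB (s y : R) : 0 < y -> is_derive y 1 (fun z => A * (z - u) ^+ k.+1 + s * c n z)
    (A * (k.+1%:R * (y - u) ^+ k) + s * (n.+1%:R * c n.+1 y)).
  move=> y0; apply: is_derive_add.
    have d1 : is_derive y 1 (fun z => (z - u) ^+ k.+1) (k.+1%:R * (y - u) ^+ k).
      have := is_deriveX k.+1 (is_deriveB (is_derive_id y 1) (is_derive_cst u y 1)).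
      rewrite /GRing.scale /= subr0 mulr1; congr (is_derive _ _ _ _).
      by apply/funext => z; rewrite fctE.
    apply: (is_derive_eq (is_derive_mul (is_derive_cst _ _ _) d1)).
    by rewrite mul0r add0r.
  apply: (is_derive_eq (is_derive_mul (is_derive_cst _ _ _) (dc n y y0))).
  by rewrite mul0r add0r.
have bound (y : R) : u <= y <= x -> n.+1%:R * `|c n.+1 y| <= A * (k.+1%:R * (y - u) ^+ k).
  move=> /andP[uy yx]; rewrite mulrA.
  have -> : A * k.+1%:R = n.+1%:R * ('C(n.+1 + k, k)%:R * M ^+ (n.+1 + k).+1).
    rewrite /A addSnnS mulrAC !mulrA -!natrM; congr (_%:R * _).
    have := mul_bin_left (n + k.+1) k; rewrite -addSnnS mulnC => ->.
    by rewrite addSn subSn ?leq_addl // addnK.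
  by rewrite -mulrA ler_wpM2l // IHk // uy (le_trans yx).
have sgn (s : R) : `|s| = 1 -> 0 <= A * (x - u) ^+ k.+1 + s * c n x.
  move=> s1; apply: le_trans (derive_le_ndecr u0 ux (dB s) _).
    by rewrite subrr expr0n mulr0 add0r cu0 mulr0.
  move=> y uyx; rewrite -lerBlDr sub0r (le_trans _ (bound y uyx)) //.
  rewrite (le_trans (ler_norm _)) // normrN normrM s1 mul1r normrM.
  by rewrite normr_nat.
have := sgn 1 (normr1 _); have := sgn (-1) (normrN1 _).
by rewrite ler_norml => ? ?; apply/andP; split; lra.
Qed.

(** The binomial coefficient of [jet_taylor] is at most [2 ^ (n + k)], hence the
radius [1 / (4 M)]. *)
Lemma jet_vanish_right (R : realType) (c : nat -> R -> R) (M u e : R) :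
  jet c -> 0 < u -> 1 <= M ->
  (forall n x, u <= x <= e -> `|c n x| <= M ^+ n.+1) ->
  (forall n, c n u = 0) ->
  forall n x, u <= x <= e -> x <= u + (4 * M)^-1 -> c n x = 0.
Proof.
move=> cj u0 M1 cM cu0 n x uxe xu.
have M0 : 0 < M by exact: lt_le_trans M1.
apply/eqP; rewrite -normr_le0; apply/ler_addgt0Pr => eps eps0; rewrite add0r.
pose K := (2 * M) ^+ n.+1.
have K0 : 0 < K by rewrite exprn_gt0 // mulr_gt0.
have [k Hk] : exists k, K * 2^-1 ^+ k < eps.
  exists (Num.bound (K / eps)); rewrite exprVn ltr_pdivrMr ?exprn_gt0 //.
  rewrite mulrC -ltr_pdivrMr // (lt_trans (archi_boundP _)) ?divr_ge0 ?ltW //.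
  by rewrite -natrX ltr_nat ltn_expl.
rewrite (le_trans _ (ltW Hk)) //.
apply: (le_trans (jet_taylor cj u0 (ltW M0) cM cu0 k n uxe)).
have /andP[ux _] := uxe.
have xu' : (x - u) ^+ k <= (4 * M)^-1 ^+ k.
  by rewrite lerXn2r ?nnegrE ?subr_ge0 ?invr_ge0 ?mulr_ge0 ?(ltW M0) // lerBlDl.
apply: (@le_trans _ _ (2 ^+ (n + k).+1 * M ^+ (n + k).+1 * (4 * M)^-1 ^+ k)).
  apply: ler_pM => //; rewrite ?mulr_ge0 ?ler0n ?exprn_ge0 ?subr_ge0 ?(ltW M0) //.
  rewrite ler_wpM2r ?exprn_ge0 ?(ltW M0) // -natrX ler_nat.
  by rewrite (leq_trans (bin_leq_exp2 _ _)) // leq_pexp2l.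
rewrite -exprMn -addSn exprD -mulrA -exprMn.
rewrite (_ : 2 * M * _ = 2^-1) //; by field; rewrite gt_eqF.
Qed.

(** Vanishing propagates to the right by steps of length [1 / (4 M)], with the
same [M] up to the point that is to be reached. *)
Lemma analytic_identity (R : realType) (f : R -> R) (a b : R) :
  analytic_pos f -> 0 < a -> a < b -> (forall x, a <= x <= b -> f x = 0) ->
  forall x, a <= x -> f x = 0.
Proof.
move=> [c cj cf] a0 ab f0 e ae; have [dc bc] := cj.
have [M M1 HM] := bc a e a0.
have M0 : 0 < M by exact: lt_le_trans M1.
have cI n : forall x, a < x < b -> c n x = 0.
  elim: n => [|n IHn] x /andP[ax xb].
    by rewrite cf ?f0 ?(ltW ax) ?(ltW xb) // (lt_trans a0).
  have x0 : 0 < x by exact: lt_trans ax.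
  have : is_derive x 1 (cst 0 : R -> R) (n.+1%:R * c n.+1 x).
    apply: near_eq_is_derive (dc n x x0).
    near=> y; apply: IHn; apply/andP; split; near: y; [exact: lt_nbhsr|exact: lt_nbhsl].
  move=> /@derive_val; rewrite derive_cst => /esym/eqP.
  by rewrite mulf_eq0 pnatr_eq0 => /eqP.
(* The Taylor coefficients vanish inside the interval; start from its middle. *)
pose u := (a + b) / 2.
have au : a < u by rewrite /u; lra.
have ub : u < b by rewrite /u; lra.
have step k : forall x, u <= x <= e -> x <= u + k%:R * (4 * M)^-1 ->
    forall n, c n x = 0.
  elim: k => [|k IHk] x /andP[ux xe] xk n.
    apply: cI; rewrite (lt_le_trans au ux) (le_lt_trans xk) // mul0r addr0 //.
  have [xk'|kx] := leP x (u + k%:R * (4 * M)^-1); first by apply: IHk; rewrite ?ux.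
  set v := u + k%:R * (4 * M)^-1 in kx.
  have uv : u <= v by rewrite lerDl mulr_ge0 // invr_ge0 mulr_ge0 // ltW.
  have vx : v <= x by exact: ltW.
  apply: (@jet_vanish_right _ c M v e cj _ M1) => //.
  - by rewrite (lt_le_trans _ uv) // (lt_trans a0).
  - by move=> m y /andP[vy ye]; rewrite HM // ye (le_trans (ltW au)) // (le_trans uv).
  - by move=> m; apply: IHk => //; rewrite uv (le_trans vx).
  - by rewrite vx.
  - by rewrite /v -addrA -{2}[(4 * M)^-1]mul1r -mulrDl natr1.
have [eu|ue] := leP e u; first by apply: f0; rewrite ae (le_trans eu) // ltW.
rewrite -cf; last by rewrite (lt_le_trans a0).
apply: (step (Num.bound ((e - u) * (4 * M)))); first by rewrite (ltW ue) lexx.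
rewrite -lerBlDl ler_pdivlMr ?mulr_gt0 // ltW // archi_boundP //.
by rewrite mulr_ge0 ?subr_ge0 ?mulr_ge0 // ltW.
Unshelve. all: by end_near. Qed.

(** * Expansions in decaying exponentials *)

Definition expO (R : realType) (l : R) (f : R -> R) : Prop :=
  exists C : R, \forall p \near +oo%R, `|f p| <= C * expR (- (l * p)).

Lemma expO_ext (R : realType) (l : R) (f g : R -> R) :
  (forall p, f p = g p) -> expO l f -> expO l g.
Proof. by move=> /funext ->. Qed.

Lemma expO_pos (R : realType) (l : R) (f : R -> R) : expO l f ->
  exists2 C : R, 0 < C & \forall p \near +oo%R, `|f p| <= C * expR (- (l * p)).
Proof.
move=> [C HC]; exists (1 + `|C|); first by rewrite ltr_pwDl.
near=> p; have : `|f p| <= C * expR (- (l * p)) by near: p.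
move=> /le_trans; apply; rewrite ler_wpM2r ?expR_ge0 //.
by rewrite (le_trans (ler_norm _)) // lerDr.
Unshelve. all: by end_near. Qed.

Lemma expO_le (R : realType) (l l' : R) (f : R -> R) :
  l <= l' -> expO l' f -> expO l f.
Proof.
move=> ll' /expO_pos[C C0 HC]; exists C; near=> p.
have : `|f p| <= C * expR (- (l' * p)) by near: p.
move=> /le_trans; apply; rewrite ler_wpM2l ?(ltW C0) // ler_expR lerN2.
by rewrite ler_wpM2r.
Unshelve. all: by end_near. Qed.

Lemma expO_add (R : realType) (l : R) (f g : R -> R) :
  expO l f -> expO l g -> expO l (fun p => f p + g p).
Proof.
move=> [C HC] [D HD]; exists (C + D); near=> p.
by rewrite mulrDl (le_trans (ler_normD _ _)) // lerD //; near: p.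
Unshelve. all: by end_near. Qed.

Lemma expO_mul (R : realType) (l m : R) (f g : R -> R) :
  expO l f -> expO m g -> expO (l + m) (fun p => f p * g p).
Proof.
move=> [C HC] [D HD]; exists (C * D); near=> p.
rewrite mulrDl opprD expRD mulrACA normrM ler_pM //; near: p => //.
Unshelve. all: by end_near. Qed.

Lemma expO_scale_exp (R : realType) (c l : R) :
  expO l (fun p => c * expR (- (l * p))).
Proof. by exists `|c|; near=> p; rewrite normrM [`|expR _|]ger0_norm ?expR_ge0.
Unshelve. all: by end_near. Qed.

Lemma expO_cst (R : realType) (c : R) : expO 0 (fun=> c).
Proof. by exists `|c|; near=> p; rewrite mul0r oppr0 expR0 mulr1.
Unshelve. all: by end_near. Qed.

Lemma expO_sum (R : realType) (l : R) (I : Type) (r : seq I) (P : pred I)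
    (f : I -> R -> R) :
  (forall i, P i -> expO l (f i)) -> expO l (fun p => \sum_(i <- r | P i) f i p).
Proof.
move=> fO; elim: r => [|i r IHr].
  by exists 0; near=> p; rewrite big_nil normr0 mul0r.
apply: (@expO_ext _ _ (fun p => (if P i then f i p else 0) +
    \sum_(i <- r | P i) f i p)).
  by move=> p; rewrite big_cons; case: ifP => // _; rewrite add0r.
apply: expO_add => //; case: (boolP (P i)) => [/fO|_]; first exact.
by exists 0; near=> p; rewrite normr0 mul0r.
Unshelve. all: by end_near. Qed.

Definition expsum (R : realType) (s : seq (R * R)) (p : R) : R :=
  \sum_(t <- s) t.1 * expR (- (t.2 * p)).

Definition rate_coef (R : realType) (s : seq (R * R)) (l : R) : R :=
  \sum_(t <- s | t.2 == l) t.1.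

Lemma seq_min (R : realType) (T : eqType) (f : T -> R) (s : seq T) :
  s != [::] -> exists2 t, t \in s & forall u, u \in s -> f t <= f u.
Proof.
elim: s => // x [|y s] IHs _.
  by exists x; rewrite ?mem_head // => u; rewrite inE => /eqP ->.
have [//|t ts Ht] := IHs; have [xt|tx] := leP (f x) (f t).
  exists x; rewrite ?mem_head // => u; rewrite in_cons => /orP[/eqP -> //|/Ht].
  exact: le_trans.
exists t => [|u]; rewrite in_cons; first by rewrite ts orbT.
by move=> /orP[/eqP ->|/Ht//]; exact: ltW.
Qed.

Lemma expO_expsum (R : realType) (l : R) (s : seq (R * R)) :
  (forall t, t \in s -> l <= t.2) -> expO l (expsum s).
Proof.
move=> ls; rewrite /expsum (_ : (fun p => _) =
    fun p => \sum_(u <- s | u \in s) u.1 * expR (- (u.2 * p))).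
  by apply: expO_sum => u /ls lu; apply: expO_le lu (expO_scale_exp _ _).
by apply/funext => p; exact: big_seq.
Qed.

Lemma expO_expsum_gt (R : realType) (l : R) (s : seq (R * R)) :
  (forall t, t \in s -> l < t.2) -> exists2 m, l < m & expO m (expsum s).
Proof.
move=> ls; have [->|s0] := eqVneq s [::].
  exists (l + 1); first by rewrite ltrDl.
  by exists 0; near=> p; rewrite /expsum big_nil normr0 mul0r.
have [t ts Ht] := @seq_min R _ snd s s0.
by exists t.2; [exact: ls|exact: expO_expsum].
Unshelve. all: by end_near. Qed.

(** Distinct exponentials are linearly independent: the terms of slowest decay
either dominate the sum, or cancel and can be removed. *)
Lemma expsum_lead (R : realType) (s : seq (R * R)) :
  (forall l, rate_coef s l = 0) /\ (forall p, expsum s p = 0) \/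
  exists (c l m : R), [/\ c != 0, l < m &
    expO m (fun p => expsum s p - c * expR (- (l * p)))].
Proof.
have [n] := ubnP (size s); elim: n s => // n IHn s; rewrite ltnS => sn.
have [->|s0] := eqVneq s [::].
  by left; split=> [l|p]; rewrite /rate_coef /expsum big_nil.
have [t ts Ht] := @seq_min R _ snd s s0.
set l := t.2 in Ht; pose s' := [seq u <- s | u.2 != l].
have sE p : expsum s p = rate_coef s l * expR (- (l * p)) + expsum s' p.
  rewrite /expsum (bigID (fun u => u.2 == l)) /= /rate_coef mulr_suml.
  rewrite [X in _ = _ + X]big_filter; congr (_ + _).
  by apply: eq_bigr => u /eqP ->.
have [cl0|cl0] := eqVneq (rate_coef s l) 0; last first.
  right; have [u|m lm mO] := @expO_expsum_gt _ l s'.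
    by rewrite mem_filter => /andP[ul /Ht]; rewrite lt_neqAle eq_sym ul.
  exists (rate_coef s l), l, m; split=> //.
  by apply: expO_ext mO => p; rewrite sE addrC addKr.
have s'n : (size s' < n)%N.
  rewrite (leq_trans _ sn) // size_filter -(count_predC (fun u => u.2 == l) s).
  rewrite -[ltnLHS]add0n ltn_add2r -has_count; apply/hasP; exists t => //=.
have [[cs' es']|[c [m [k [c0 mk H]]]]] := IHn s' s'n; [left|right].
  split=> [m|p]; last by rewrite sE cl0 mul0r add0r es'.
  have [->//|ml] := eqVneq m l; rewrite -(cs' m) /rate_coef big_filter_cond.
  by apply: eq_bigl => u; case: (eqVneq u.2 m) => [->|]; rewrite ?ml ?andbF.
exists c, m, k; split=> //.
by apply: expO_ext H => p; rewrite sE cl0 mul0r add0r.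
Qed.

(** Asymptotic expansion at infinity in decaying exponentials, up to an error
decaying as fast as wanted; the number of terms may grow with the precision. *)
Definition expandable (R : realType) (f : R -> R) : Prop :=
  forall l : R, exists2 s : seq (R * R), all (fun t : R * R => 0 <= t.2) s &
    expO l (fun p => f p - expsum s p).

Lemma expsum_cat (R : realType) (s t : seq (R * R)) p :
  expsum (s ++ t) p = expsum s p + expsum t p.
Proof. by rewrite /expsum big_cat. Qed.

Lemma expandable_expsum (R : realType) (s : seq (R * R)) :
  all (fun t : R * R => 0 <= t.2) s -> expandable (expsum s).
Proof.
move=> s0 l; exists s => //; exists 0; near=> p.
by rewrite subrr normr0 mul0r.
Unshelve. all: by end_near. Qed.

Lemma expandable_ext (R : realType) (f g : R -> R) :
  (forall p, f p = g p) -> expandable f -> expandable g.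
Proof. by move=> /funext ->. Qed.

Lemma expandable_cst (R : realType) (c : R) : expandable (fun=> c).
Proof.
apply: (@expandable_ext _ (expsum [:: (c, 0)])).
  by move=> p; rewrite /expsum big_seq1 mul0r oppr0 expR0 mulr1.
by apply: expandable_expsum; rewrite /= lexx.
Qed.

Lemma expandable_add (R : realType) (f g : R -> R) :
  expandable f -> expandable g -> expandable (fun p => f p + g p).
Proof.
move=> fE gE l; have [s s0 fs] := fE l; have [t t0 gt] := gE l.
exists (s ++ t); first by rewrite all_cat s0.
apply: expO_ext (expO_add fs gt) => p.
by rewrite expsum_cat; ring.
Qed.

Lemma expsum_bounded (R : realType) (s : seq (R * R)) :
  all (fun t : R * R => 0 <= t.2) s -> expO 0 (expsum s).
Proof.
by move=> /allP; exact: expO_expsum.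
Qed.

Lemma expandable_bounded (R : realType) (f : R -> R) : expandable f -> expO 0 f.
Proof.
move=> /(_ 0)[s s0 fs]; apply: expO_ext (expO_add fs (expsum_bounded s0)) => p.
by rewrite subrK.
Qed.

Lemma expandable_mul (R : realType) (f g : R -> R) :
  expandable f -> expandable g -> expandable (fun p => f p * g p).
Proof.
move=> /[dup] /expandable_bounded f0 fE gE l.
have [s s0 fs] := fE l; have [t t0 gt] := gE l.
exists [seq (u.1 * w.1, u.2 + w.2) | u <- s, w <- t].
  by apply/allP => _ /allpairsP[[u w] /= [us wt ->]] /=;
     rewrite addr_ge0 ?(allP s0 _ us) ?(allP t0 _ wt).
have := expO_add (expO_mul f0 gt) (expO_mul (expsum_bounded t0) fs).
rewrite add0r; apply: expO_ext => p.
have -> : expsum [seq (u.1 * w.1, u.2 + w.2) | u <- s, w <- t] p =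
    expsum s p * expsum t p.
  rewrite /expsum big_allpairs_dep /= mulr_suml; apply: eq_bigr => u _.
  rewrite mulr_sumr; apply: eq_bigr => w _ /=.
  by rewrite mulrDl opprD expRD; ring.
by ring.
Qed.

Lemma expandable_sum (R : realType) (I : Type) (r : seq I) (f : I -> R -> R) :
  (forall i, expandable (f i)) -> expandable (fun p => \sum_(i <- r) f i p).
Proof.
move=> fE; elim: r => [|i r IHr].
  by apply: expandable_ext (expandable_cst 0) => p; rewrite big_nil.
by apply: expandable_ext (expandable_add (fE i) IHr) => p; rewrite big_cons.
Qed.

Lemma expandable_exp (R : realType) (f : R -> R) n :
  expandable f -> expandable (fun p => f p ^+ n).
Proof.
move=> fE; elim: n => [|n IHn]; first exact: expandable_cst 1.
by apply: expandable_ext (expandable_mul fE IHn) => p; rewrite exprS.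
Qed.

Lemma expandable_approx (R : realType) (f : R -> R) :
  (forall l, exists2 g, expandable g & expO l (fun p => f p - g p)) ->
  expandable f.
Proof.
move=> fE l; have [g /(_ l)[s s0 gs] fg] := fE l; exists s => //.
by apply: expO_ext (expO_add fg gs) => p; rewrite addrA subrK.
Qed.

(** * Logarithms of sums of exponentials *)

(** The remainder has derivative [(- y) ^ n / (1 + y)]. *)
Lemma ln1p_taylor (R : realType) (x : R) n : 0 <= x ->
  `|ln (1 + x) - \sum_(j < n) (-1) ^+ j / j.+1%:R * x ^+ j.+1| <= x ^+ n.+1.
Proof.
move=> x0.
pose f (y : R) := ln (1 + y) - \sum_(j < n) (-1) ^+ j / j.+1%:R * y ^+ j.+1.
have df (y : R) : 0 <= y -> is_derive y 1 f ((- y) ^+ n / (1 + y)).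
  move=> y0; have y1 : 0 < 1 + y by rewrite ltr_pwDl.
  have dln : is_derive y 1 (fun z => ln (1 + z)) ((1 + y)^-1).
    have d1 : is_derive y 1 (fun z : R => 1 + z) 1.
      apply: (is_derive_eq (is_derive_add (is_derive_cst (1 : R) y 1)
        (is_derive_id y 1))).
      by rewrite add0r.
    have := @is_derive1_comp R (@ln R) _ y _ _ (is_derive1_ln y1) d1.
    by rewrite mulr1.
  have dS : is_derive y 1
      (fun z => \sum_(j < n) (-1) ^+ j / j.+1%:R * z ^+ j.+1)
      (\sum_(j < n) (- y) ^+ j).
    apply: is_derive_sumf => j.
    have dX : is_derive y 1 (fun z => z ^+ j.+1) (j.+1%:R * y ^+ j).
      have := is_deriveX j.+1 (is_derive_id y 1).
      rewrite /GRing.scale /= mulr1; congr (is_derive _ _ _ _).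
      by apply/funext => z; rewrite fctE.
    apply: (is_derive_eq (is_derive_mul (is_derive_cst _ _ _) dX)).
    by rewrite mul0r add0r mulrA divfK ?pnatr_eq0 // -exprMn mulN1r.
  apply: (is_derive_eq (is_deriveB dln dS)).
  have := subrXX 1 (- y) n; rewrite expr1n opprK.
  rewrite (eq_bigr (fun i : 'I_n => (- y) ^+ i)) => [E|i _]; last first.
    by rewrite expr1n mul1r.
  apply: (mulIf (lt0r_neq0 y1)); rewrite divfK ?lt0r_neq0 //.
  rewrite mulrBl mulVf ?lt0r_neq0 // [_ * (1 + y)]mulrC -E; ring.
have [||c] := @MVT_segment _ f (fun y => (- y) ^+ n / (1 + y)) 0 x x0.
- by move=> y; rewrite in_itv /= => /andP[y0 _]; apply: df; exact: ltW.
- apply: derivable_within_continuous => y; rewrite in_itv /= => /andP[y0 _].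
  by case: (df y y0).
rewrite in_itv /= => /andP[c0 cx].
have f0 : f 0 = 0.
  rewrite /f addr0 ln1 sub0r big1 ?oppr0 // => j _.
  by rewrite expr0n mulr0.
rewrite f0 !subr0 -/(f x) => ->.
rewrite exprSr normrM (ger0_norm x0) ler_wpM2r // normrM normrX normrN.
rewrite (ger0_norm c0) normfV ger0_norm ?addr_ge0 //.
apply: (@le_trans _ _ (c ^+ n)); last by rewrite lerXn2r ?nnegrE.
by rewrite ler_piMr ?exprn_ge0 // invf_le1 ?ltr_pwDl // lerDl.
Qed.

Lemma expO_exp (R : realType) (l : R) (f : R -> R) n :
  expO l f -> expO (n%:R * l) (fun p => f p ^+ n).
Proof.
move=> fO; elim: n => [|n IHn]; first by rewrite mul0r; exact: expO_cst.
have := expO_mul fO IHn.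
rewrite (_ : l + _ = n.+1%:R * l); last by rewrite -[n.+1%:R]natr1; ring.
by apply: expO_ext => p; rewrite exprS.
Qed.

Lemma expandable_ln1p (R : realType) (u : R -> R) (l : R) :
  0 < l -> (forall p, 0 <= u p) -> expO l u -> expandable u ->
  expandable (fun p => ln (1 + u p)).
Proof.
move=> l0 u0 uO uE; apply: expandable_approx => m.
pose n := Num.bound (`|m| / l).
exists (fun p => \sum_(j < n) (-1) ^+ j / j.+1%:R * u p ^+ j.+1).
  apply: expandable_sum => j.
  by apply: expandable_mul (expandable_cst _) (expandable_exp _ uE).
have [C HC] := expO_exp n.+1 uO.
apply: (@expO_le _ _ (n.+1%:R * l)).
  rewrite (le_trans (ler_norm m)) // -ler_pdivrMr // ltW //.
  apply: (@lt_le_trans _ _ n%:R); last by rewrite ler_nat.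
  by rewrite archi_boundP // divr_ge0 ?(ltW l0).
exists C; near=> p; apply: (le_trans (ln1p_taylor n (u0 p))).
have : `|u p ^+ n.+1| <= C * expR (- (n.+1%:R * l * p)) by near: p.
by rewrite ger0_norm ?exprn_ge0.
Unshelve. all: by end_near. Qed.

(** The [p]-th power of the [p]-norm of the vector with entries [expR (- r)],
for [r] in [s]. *)
Definition powsum (R : realType) (s : seq R) (p : R) : R :=
  \sum_(r <- s) expR (- (r * p)).

Lemma powsumE (R : realType) (s : seq R) (p : R) :
  powsum s p = expsum [seq (1, r) | r <- s] p.
Proof.
by rewrite /powsum /expsum big_map; apply: eq_bigr => r _; rewrite mul1r.
Qed.

Lemma powsum_ge1 (R : realType) (s : seq R) (p : R) : 0 \in s -> 1 <= powsum s p.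
Proof.
move=> s0; rewrite /powsum (big_rem 0) //= mul0r oppr0 expR0 lerDl.
by rewrite sumr_ge0 // => r _; rewrite expR_ge0.
Qed.

Lemma powsum_le_size (R : realType) (s : seq R) (p : R) :
  all (fun r => 0 <= r) s -> 0 <= p -> powsum s p <= (size s)%:R.
Proof.
move=> /allP s0 p0; rewrite /powsum -sum1_size natr_sum big_seq [leRHS]big_seq.
by apply: ler_sum => r /s0 r0; rewrite expR_le1 oppr_le0 mulr_ge0.
Qed.

(** The rates equal to [0] contribute a positive integer [m]; the rest is
[m * u] with [u] decaying exponentially, and [ln (1 + u)] is expanded by
Taylor's formula. *)
Lemma expandable_ln_powsum (R : realType) (s : seq R) :
  all (fun r => 0 <= r) s -> 0 \in s -> expandable (fun p => ln (powsum s p)).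
Proof.
move=> s0 s1; pose m : R := (count_mem 0 s)%:R.
pose u p := m^-1 * expsum [seq (1, r) | r <- s & r != 0] p.
have m0 : 0 < m by rewrite ltr0n -has_count has_pred1.
have sE p : powsum s p = m * (1 + u p).
  rewrite mulrDr mulr1 mulVKf ?gt_eqF // /expsum big_map big_filter.
  rewrite /powsum (bigID (pred1 0)) /=; congr (_ + _).
    rewrite (eq_bigr (fun=> 1)) => [|r /eqP ->]; last first.
      by rewrite mul0r oppr0 expR0.
    by rewrite -big_filter big_const_seq count_predT size_filter iter_addr_0.
  by apply: eq_bigr => r _; rewrite mul1r.
have u0 p : 0 <= u p.
  rewrite mulr_ge0 ?invr_ge0 ?(ltW m0) // /expsum big_map sumr_ge0 // => r _.
  by rewrite mul1r expR_ge0.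
have uE : expandable u.
  apply: expandable_mul (expandable_cst _) (expandable_expsum _).
  rewrite all_map all_filter; apply/allP => r /(allP s0) r0 /=.
  by rewrite r0 implybT.
have [|l l0 lO] := @expO_expsum_gt _ 0 [seq (1, r) | r <- s & r != 0].
  move=> _ /mapP[r + ->] /=; rewrite mem_filter => /andP[rn0 /(allP s0) r0].
  by rewrite lt_neqAle eq_sym rn0.
have uO : expO l u by have := expO_mul (expO_cst m^-1) lO; rewrite add0r.
apply: (@expandable_ext _ (fun p => ln m + ln (1 + u p))).
  by move=> p; rewrite sE lnM // posrE ltr_pwDl.
apply: expandable_add (expandable_cst _) (expandable_ln1p l0 u0 uO uE).
Qed.

(** A function that decays less than some exponential is equivalent to the
leading term of its expansion at that precision. *)
Lemma expandable_lead (R : realType) (f : R -> R) : expandable f ->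
  (forall l, expO l f) \/
  exists (c l m : R), [/\ c != 0, l < m &
    expO m (fun p => f p - c * expR (- (l * p)))].
Proof.
move=> fE; have [|/existsNP[l0 nf]] := EM (forall l, expO l f); first by left.
right; have [s _ fs] := fE l0.
have [[_ es]|[c [l [m [c0 lm H]]]]] := expsum_lead s.
  by case: nf; apply: expO_ext fs => p; rewrite es subr0.
have [l0l|ll0] := leP l0 l.
  case: nf; apply: (@expO_ext _ _ (fun p => f p - expsum s p +
      (expsum s p - c * expR (- (l * p)) + c * expR (- (l * p))))).
    by move=> p; ring.
  apply: expO_add => //; apply: expO_add; last exact: expO_le (expO_scale_exp _ _).
  by apply: expO_le H; rewrite ltW // (le_lt_trans l0l).
exists c, l, (Num.min l0 m); split; rewrite ?lt_min ?ll0 //.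
apply: (@expO_ext _ _ (fun p => f p - expsum s p +
    (expsum s p - c * expR (- (l * p))))); first by move=> p; ring.
by apply: expO_add; [apply: expO_le fs|apply: expO_le H]; rewrite ge_min lexx ?orbT.
Qed.

(** The slowest of the individual leading exponentials serves for the whole
family; the functions that decay faster get the coefficient [0]. *)
Lemma expandable_family_lead (R : realType) n (f : nat -> R -> R) :
  (forall i, expandable (f i)) ->
  (forall i, (i < n)%N -> forall l, expO l (f i)) \/
  exists (c : nat -> R) (l m : R), [/\ l < m,
    exists2 i, (i < n)%N & c i != 0 &
    forall i, (i < n)%N -> expO m (fun p => f i p - c i * expR (- (l * p)))].
Proof.
move=> fE; elim: n => [|n IHn]; first by left.
have lead0 (g : R -> R) (l m : R) : expO m g ->
    expO m (fun p => g p - 0 * expR (- (l * p))).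
  by apply: expO_ext => p; rewrite mul0r subr0.
have [H|[d [k [r [d0 kr H]]]]] := expandable_lead (fE n);
  have [H'|[c [l [m [lm [i0 i0n ci0] H']]]]] := IHn.
- by left=> i; rewrite ltnS leq_eqVlt => /orP[/eqP ->|/H'].
- right; exists (fun i => if (i < n)%N then c i else 0), l, m; split=> //.
    by exists i0; [exact: ltnW|rewrite i0n].
  move=> i; rewrite ltnS leq_eqVlt => /orP[/eqP ->|/[dup] ni ->]; last exact: H'.
  by rewrite ltnn; apply: lead0.
- right; exists (fun i => if (i < n)%N then 0 else d), k, r; split=> //.
    by exists n; rewrite ?ltnn.
  move=> i; rewrite ltnS leq_eqVlt => /orP[/eqP ->|/[dup] ni ->].
    by rewrite ltnn.
  by apply: lead0; exact: H'.
have shift (g : R -> R) (e x y z : R) : x < y -> x < z ->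
    expO z (fun p => g p - e * expR (- (y * p))) -> expO (Num.min y z) g.
  move=> xy xz gO.
  apply: (@expO_ext _ _ (fun p => g p - e * expR (- (y * p)) +
    e * expR (- (y * p)))); first by move=> p; rewrite subrK.
  by apply: expO_add; [apply: expO_le gO|apply: expO_le (expO_scale_exp _ _)];
     rewrite ge_min lexx ?orbT.
right; have [lk|kl|lk] := ltrgtP l k.
- have rl := lt_trans lk kr.
  exists (fun i => if (i < n)%N then c i else 0), l, (Num.min m (Num.min k r)).
  split; rewrite ?lt_min ?lm ?lk ?rl //.
    by exists i0; [exact: ltnW|rewrite i0n].
  move=> i; rewrite ltnS leq_eqVlt => /orP[/eqP ->|/[dup] ni ->].
    rewrite ltnn; apply: lead0; apply: expO_le (shift _ _ _ _ _ lk rl H).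
    by rewrite ge_min lexx orbT.
  by apply: expO_le (H' i ni); rewrite ge_min lexx.
- have ml := lt_trans kl lm.
  exists (fun i => if (i < n)%N then 0 else d), k, (Num.min r (Num.min l m)).
  split; rewrite ?lt_min ?kr ?kl ?ml //.
    by exists n; rewrite ?ltnn.
  move=> i; rewrite ltnS leq_eqVlt => /orP[/eqP ->|/[dup] ni ->].
    by rewrite ltnn; apply: expO_le H; rewrite ge_min lexx.
  apply: lead0; apply: expO_le (shift _ _ _ _ _ kl ml (H' i ni)).
  by rewrite ge_min lexx orbT.
- rewrite -lk in kr H.
  exists (fun i => if (i < n)%N then c i else d), l, (Num.min m r).
  split; rewrite ?lt_min ?lm //.
    by exists i0; [exact: ltnW|rewrite i0n].
  move=> i; rewrite ltnS leq_eqVlt => /orP[/eqP ->|/[dup] ni ->].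
    by rewrite ltnn; apply: expO_le H; rewrite ge_min lexx orbT.
  by apply: expO_le (H' i ni); rewrite ge_min lexx.
Qed.

(** * Power sums and exponential sums *)

Lemma coef_prod_XsubC_le (R : realType) (s : seq R) (B : R) i :
  0 <= B -> (forall a, a \in s -> `|a| <= B) ->
  `|(\prod_(a <- s) ('X - a%:P))`_i| <= (1 + B) ^+ size s.
Proof.
move=> B0; elim: s i => [|a s IHs] i sB.
  by rewrite big_nil coef1 expr0 normr_nat; case: eqP.
have {}IHs j : `|(\prod_(a <- s) ('X - a%:P))`_j| <= (1 + B) ^+ size s.
  by apply: IHs => b bs; apply: sB; rewrite in_cons bs orbT.
rewrite big_cons mulrBl coefB coefXM coefCM exprS mulrDl mul1r.
rewrite (le_trans (ler_normB _ _)) // lerD //.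
  by case: eqP => // _; rewrite normr0 exprn_ge0 ?addr_ge0.
by rewrite normrM ler_pM // sB ?mem_head.
Qed.

Definition power_sum (R : realType) n (b L : 'I_n -> R) (j : nat) : R :=
  \sum_k b k * L k ^+ j.

Definition power_sum_norm (R : realType) n (b L : 'I_n -> R) : R :=
  \sum_(i < n) `|power_sum b L i|.

(** Every [L k] is a root of [\prod_k ('X - L k)], so that each power sum is a
combination of the [n] preceding ones, with bounded coefficients. *)
Lemma power_sum_growth (R : realType) n (b L : 'I_n -> R) (B : R) (j : nat) :
  0 <= B -> (forall k, `|L k| <= B) ->
  `|power_sum b L j| <=
    (1 + n%:R * (1 + B) ^+ n) ^+ j * power_sum_norm b L.
Proof.
move=> B0 LB; set D := 1 + _.
have D1 : 1 <= D by rewrite lerDl mulr_ge0 // exprn_ge0 // addr_ge0.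
have D0 : 0 <= D by exact: le_trans D1.
have M0 : 0 <= power_sum_norm b L by rewrite sumr_ge0.
have [m] := ubnP j; elim: m j => // m IHm j; rewrite ltnS => jm.
have [jn|nj] := ltnP j n.
  apply: (@le_trans _ _ (power_sum_norm b L)); last by rewrite ler_peMl ?exprn_ege1.
  rewrite /power_sum_norm (bigD1 (Ordinal jn)) //= lerDl sumr_ge0 //.
pose s := [seq L k | k <- enum 'I_n].
pose q := \prod_(a <- s) ('X - a%:P).
have ss : size s = n by rewrite size_map size_enum_ord.
have sq : size q = n.+1 by rewrite size_prod_XsubC ss.
have qn : q`_n = 1.
  by have := monic_prod_XsubC s xpredT id; rewrite monicE lead_coefE -/q sq => /eqP.
have qB i : `|q`_i| <= (1 + B) ^+ n.
  by rewrite -ss coef_prod_XsubC_le // => _ /mapP[k _ ->].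
have E : power_sum b L j = - \sum_(i < n) q`_i * power_sum b L (j - n + i)%N.
  apply/eqP; rewrite -addr_eq0 addrC; apply/eqP.
  transitivity (\sum_(i < n.+1) q`_i * power_sum b L (j - n + i)%N).
    by rewrite big_ord_recr /= qn mul1r subnK.
  rewrite /power_sum (eq_bigr (fun i : 'I_n.+1 =>
    \sum_k b k * L k ^+ (j - n) * (q`_i * L k ^+ i))); last first.
    move=> i _; rewrite mulr_sumr; apply: eq_bigr => k _.
    by rewrite exprD; ring.
  rewrite exchange_big big1 //= => k _; rewrite -mulr_sumr.
  rewrite -(horner_coef_wide (L k) (_ : size q <= n.+1)%N) ?sq //.
  suff /rootP -> : root q (L k) by rewrite mulr0.
  by rewrite root_prod_XsubC map_f // mem_enum.
rewrite E normrN (le_trans (ler_norm_sum _ _ _)) //.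
have [n0|n0] := posnP n.
  by rewrite big1 ?mulr_ge0 ?exprn_ge0 // => i; have := ltn_ord i; lia.
apply: (@le_trans _ _ (\sum_(i < n) (1 + B) ^+ n * (D ^+ j.-1 * power_sum_norm b L))).
  apply: ler_sum => i _; have ni := ltn_ord i.
  rewrite normrM ler_pM // (le_trans (IHm _ _)) //; first by lia.
  by rewrite ler_wpM2r // ler_weXn2l //; lia.
rewrite sumr_const card_ord -[leLHS]mulr_natl mulrA mulrA.
apply: ler_wpM2r => //; rewrite -[in leRHS](prednK (leq_trans n0 nj)) exprS.
by rewrite ler_wpM2r ?exprn_ge0 // lerDr.
Qed.

Lemma exp_partial_sum_le (R : realType) (x : R) J : 0 <= x ->
  \sum_(j < J) x ^+ j / j`!%:R <= expR x.
Proof.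
move=> x0; rewrite -(big_mkord xpredT (fun j => x ^+ j / j`!%:R)).
apply: nondecreasing_cvgn_le; last exact: is_cvg_series_exp_coeff.
apply: nondecreasing_series => j _ _.
by rewrite /exp_coeff /= divr_ge0 ?exprn_ge0.
Qed.

(** The tail of the exponential series only involves the power sums of order at
least [n], which are controlled by the first [n] of them. The point of bounding
the error by [power_sum_norm], rather than by a constant, is that it is as small
as the power sums themselves when [L] depends on [p]. *)
Lemma exp_sum_approx (R : realType) n (b L : 'I_n -> R) (B t : R) :
  0 <= B -> (forall k, `|L k| <= B) -> 0 <= t <= 1 ->
  `|\sum_k b k * expR (t * L k) -
    \sum_(i < n) t ^+ i / i`!%:R * power_sum b L i| <=
  t ^+ n * expR (1 + n%:R * (1 + B) ^+ n) * power_sum_norm b L.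
Proof.
move=> B0 LB /andP[t0 t1]; set D := 1 + _; set M := power_sum_norm b L.
have D0 : 0 <= D by rewrite addr_ge0 // mulr_ge0 // exprn_ge0 // addr_ge0.
have M0 : 0 <= M by rewrite sumr_ge0.
pose u J := \sum_(j < J) t ^+ j / j`!%:R * power_sum b L j.
rewrite -/(u n).
have uE J : u J = \sum_k b k * series (exp_coeff (t * L k)) J.
  rewrite /u /series /= (eq_bigr (fun j : 'I_J =>
    \sum_k b k * ((t * L k) ^+ j / j`!%:R))) => [|j _]; last first.
    by rewrite mulr_sumr; apply: eq_bigr => k _; rewrite exprMn; ring.
  rewrite exchange_big /=; apply: eq_bigr => k _.
  by rewrite big_mkord mulr_sumr.
have ucvg : (u @ \oo --> \sum_k b k * expR (t * L k))%classic.
  rewrite (_ : u = fun J => \sum_k b k * series (exp_coeff (t * L k)) J).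
    2: exact/funext.
  apply: cvg_big => // [|k _]; first exact: add_continuous.
  by apply: cvgM; [exact: cvg_cst|exact: is_cvg_series_exp_coeff].
apply/ler_addgt0Pr => e e0.
move/cvgrPdist_lt : ucvg => /(_ e e0)[J0 _ HJ].
pose J := (n + J0)%N.
have /HJ{}HJ : (J0 <= J)%N by exact: leq_addl.
rewrite -(subrK (u J) (\sum_k _)) -addrA addrC (le_trans (ler_normD _ _)) //.
rewrite lerD //; last exact: ltW.
have -> : u J - u n = \sum_(j < J0) t ^+ (n + j) / (n + j)`!%:R * power_sum b L (n + j).
  by rewrite /u /J big_split_ord /= addrAC subrr add0r.
rewrite (le_trans (ler_norm_sum _ _ _)) //.
apply: (@le_trans _ _ (\sum_(j < J0) t ^+ n * (D ^+ (n + j) / (n + j)`!%:R) * M)).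
  apply: ler_sum => j _; rewrite normrM (ger0_norm (divr_ge0 _ _)) ?exprn_ge0 //.
  have H := power_sum_growth b (n + j) B0 LB.
  rewrite (le_trans (ler_wpM2l _ H)) ?divr_ge0 ?exprn_ge0 // -/D -/M.
  rewrite [leLHS]mulrA; apply: ler_wpM2r => //.
  rewrite mulrAC -mulrA; apply: ler_wpM2r; first by rewrite divr_ge0 ?exprn_ge0.
  by rewrite exprD ler_piMr ?exprn_ge0 // exprn_ile1.
rewrite -mulr_suml -mulr_sumr ler_wpM2r // ler_wpM2l ?exprn_ge0 //.
apply: le_trans (exp_partial_sum_le J D0); rewrite big_split_ord /= lerDr.
by rewrite sumr_ge0 // => i _; rewrite divr_ge0 ?exprn_ge0.
Qed.

Lemma le_inv_near_pinfty_eq0 (R : realType) (a C : R) :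
  (\forall p \near +oo%R, `|a| <= C * p^-1) -> a = 0.
Proof.
move=> H; apply/eqP; rewrite -normr_le0; apply/ler_addgt0Pr => e e0.
rewrite add0r; near (+oo%R : set_system R) => p.
have p0 : 0 < p by near: p; exact: nbhs_pinfty_gt.
have : `|a| <= C * p^-1 by near: p.
move=> /le_trans; apply; rewrite ler_pdivrMr //.
rewrite mulrC -ler_pdivrMr //.
Unshelve. all: by end_near. Qed.

Lemma poly_inv_flat (R : realType) n (a : nat -> R) (C : R) :
  (\forall p \near +oo%R, `|\sum_(i < n) a i * p^-1 ^+ i| <= C * p^-1 ^+ n) ->
  forall i, (i < n)%N -> a i = 0.
Proof.
elim: n a => // n IHn a H.
have a0 : a 0%N = 0.
  apply: (@le_inv_near_pinfty_eq0 _ _ (`|C| + \sum_(i < n) `|a i.+1|)).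
  near=> p; have p1 : 1 <= p by near: p; exact: nbhs_pinfty_ge.
  have p0 : 0 < p by exact: lt_le_trans p1.
  have q1 : p^-1 <= 1 by rewrite invf_le1.
  have q0 : 0 <= p^-1 by rewrite invr_ge0 ltW.
  have : `|\sum_(i < n.+1) a i * p^-1 ^+ i| <= C * p^-1 ^+ n.+1 by near: p.
  rewrite big_ord_recl /= expr0 mulr1 mulrDl.
  rewrite -{2}(addrK (\sum_(i < n) a i.+1 * p^-1 ^+ i.+1) (a 0%N)) => H1.
  rewrite (le_trans (ler_normB _ _)) // lerD //.
    rewrite (le_trans H1) // (le_trans (ler_norm _)) // normrM ler_wpM2l //.
    by rewrite normrX ger0_norm // exprS ler_piMr // exprn_ile1.
  rewrite (le_trans (ler_norm_sum _ _ _)) // mulr_suml ler_sum // => i _.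
  by rewrite normrM ler_wpM2l // normrX ger0_norm // exprS ler_piMr // exprn_ile1.
case=> // i; rewrite ltnS; apply: (IHn (fun i => a i.+1)).
near=> p; have p0 : 0 < p by near: p; exact: nbhs_pinfty_gt.
have : `|\sum_(i < n.+1) a i * p^-1 ^+ i| <= C * p^-1 ^+ n.+1 by near: p.
rewrite big_ord_recl a0 mul0r add0r.
rewrite (eq_bigr (fun i : 'I_n => p^-1 * (a i.+1 * p^-1 ^+ i))); last first.
  by move=> k _; rewrite /= exprS; ring.
rewrite -mulr_sumr normrM ger0_norm ?invr_ge0 ?(ltW p0) // exprS mulrCA.
by rewrite ler_pM2l // invr_gt0.
Unshelve. all: by end_near. Qed.

Lemma expO_inv_pow (R : realType) (l : R) n (f : R -> R) : 0 < l -> expO l f ->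
  exists2 C, 0 < C & \forall p \near +oo%R, `|f p| <= C * p^-1 ^+ n.
Proof.
move=> l0 /expO_pos[C C0 HC].
(* The bound [1 + x <= expR x] at [x = l p / (n + 1)], raised to the power
   [n + 1]. *)
pose K : R := (n.+1%:R / l) ^+ n.+1.
have K0 : 0 < K by rewrite exprn_gt0 // divr_gt0.
exists (C * K); first exact: mulr_gt0.
near=> p; have p1 : 1 <= p by near: p; exact: nbhs_pinfty_ge.
have p0 : 0 < p by exact: lt_le_trans p1.
have : `|f p| <= C * expR (- (l * p)) by near: p.
move=> /le_trans; apply; rewrite -mulrA ler_wpM2l ?(ltW C0) //.
have lp0 : 0 < l * p / n.+1%:R by rewrite divr_gt0 ?mulr_gt0.
have -> : expR (- (l * p)) = (expR (l * p / n.+1%:R))^-1 ^+ n.+1.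
  by rewrite expRN exprVn -expRM_natl [_%:R * _]mulrC divfK // pnatr_eq0.
apply: (@le_trans _ _ (K * p^-1 ^+ n.+1)).
  rewrite -exprMn lerXn2r ?nnegrE ?invr_ge0 ?expR_ge0 //.
    by rewrite mulr_ge0 ?divr_ge0 ?invr_ge0 ?(ltW p0) ?(ltW l0).
  have -> : n.+1%:R / l * p^-1 = (l * p / n.+1%:R)^-1.
    by field; rewrite (gt_eqF p0) (gt_eqF l0) addrC natr1 pnatr_eq0.
  rewrite lef_pV2 ?posrE ?expR_gt0 // (le_trans _ (expR_ge1Dx _)) //.
  by rewrite lerDr.
rewrite ler_wpM2l ?(ltW K0) // exprS ler_piMl ?exprn_ge0 ?invr_ge0 ?(ltW p0) //.
by rewrite invf_le1.
Unshelve. all: by end_near. Qed.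

(** * Separation of the classes at infinity *)

Lemma ln_le_id (R : realType) (x : R) : 0 < x -> ln x <= x.
Proof.
move=> x0; have := expR_ge1Dx (ln x); rewrite lnK ?posrE // => H.
by rewrite (le_trans _ H) // lerDr.
Qed.

Lemma ln_powsum_bounded (R : realType) (s : seq R) (p : R) :
  all (fun r => 0 <= r) s -> 0 \in s -> 0 <= p ->
  `|ln (powsum s p)| <= (size s)%:R.
Proof.
move=> s0 s1 p0; have s2 := powsum_ge1 p s1.
rewrite ger0_norm ?ln_ge0 // (le_trans (ln_le_id _)) ?powsum_le_size //.
exact: lt_le_trans s2.
Qed.

(** Otherwise let [expR (- (l * p))] be the leading exponential of the power
sums, with coefficients [c i] that are not all zero. Dividing
[exp_sum_approx] at [t = 1 / p] by it leaves
[\sum_(i < n) c i / i! * p ^- i = O (p ^- n)], which forces every [c i] to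
vanish: exponentials in [p] cannot compensate powers of [1 / p]. *)
Lemma power_sum_flat (R : realType) n (b : 'I_n -> R) (s : 'I_n -> seq R) :
  (forall k, all (fun r => 0 <= r) (s k)) -> (forall k, 0 \in s k) ->
  (\forall p \near +oo%R, \sum_k b k * expR (p^-1 * ln (powsum (s k) p)) = 0) ->
  forall i, (i < n)%N ->
  forall l, expO l (fun p => power_sum b (fun k => ln (powsum (s k) p)) i).
Proof.
move=> s_ge0 s_0 H; pose L p k := ln (powsum (s k) p).
pose B : R := \sum_k (size (s k))%:R.
have B0 : 0 <= B by rewrite sumr_ge0.
have LB (p : R) k : 0 <= p -> `|L p k| <= B.
  move=> p0; rewrite (le_trans (ln_powsum_bounded (s_ge0 k) (s_0 k) p0)) //.
  by rewrite /B (bigD1 k) //= lerDl sumr_ge0.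
pose f i p := power_sum b (L p) i.
have fE i : expandable (f i).
  apply: expandable_sum => k; apply: expandable_mul (expandable_cst _) _.
  exact/expandable_exp/expandable_ln_powsum.
have [//|[c [l [m [lm [i0 i0n ci0] fO]]]]] := expandable_family_lead n fE.
exfalso; move/eqP: ci0; apply.
(* The error terms, relative to the leading exponential. *)
pose r p := \sum_(i < n) `|f i p - c i * expR (- (l * p))| * expR (l * p).
have rO : expO (m - l) r.
  apply: expO_sum => i _; apply: expO_mul.
    by have [C HC] := fO i (ltn_ord i); exists C; near=> p; rewrite normr_id; near: p.
  by apply: (@expO_ext _ _ _ _ _ (expO_scale_exp 1 (- l))) => p; rewrite mulNr opprK mul1r.
have r0 p : 0 <= r p by rewrite sumr_ge0 // => i _; rewrite mulr_ge0 ?expR_ge0.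
have ml0 : 0 < m - l by rewrite subr_gt0.
have [C C0 HC] := expO_inv_pow n ml0 rO.
pose K := expR (1 + n%:R * (1 + B) ^+ n).
pose c1 := \sum_(i < n) `|c i|.
suff /(@poly_inv_flat _ _ (fun i => c i / i`!%:R))/(_ i0 i0n)/eqP : \forall p \near +oo%R,
    `|\sum_(i < n) (c i / i`!%:R) * p^-1 ^+ i| <= (K * (c1 + C) + C) * p^-1 ^+ n.
  by rewrite mulf_eq0 invr_eq0 pnatr_eq0 eqn0Ngt fact_gt0 orbF => /eqP.
near=> p; have p1 : 1 <= p by near: p; exact: nbhs_pinfty_ge.
have p0 : 0 < p by exact: lt_le_trans p1.
have t0 : 0 <= p^-1 by rewrite invr_ge0 ltW.
have t1 : p^-1 <= 1 by rewrite invf_le1.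
have Hp : \sum_k b k * expR (p^-1 * L p k) = 0 by near: p.
have rp : r p <= C * p^-1 ^+ n by rewrite -[leLHS]ger0_norm //; near: p.
have t01 : 0 <= p^-1 <= 1 by rewrite t0.
have := exp_sum_approx b B0 (fun k => LB p k (ltW p0)) t01.
rewrite Hp sub0r normrN -/K.
set S := \sum_(i < n) _; set e := expR (- (l * p)) => HS.
have e0 : 0 < e by exact: expR_gt0.
have rE i : `|f i p - c i * e| * expR (l * p) = `|f i p - c i * e| / e.
  by rewrite /e expRN invrK.
have normM : power_sum_norm b (L p) <= e * (c1 + r p).
  rewrite /power_sum_norm /c1 /r -big_split mulr_sumr ler_sum // => i _.
  rewrite /= rE mulrDr mulrCA divff ?gt_eqF // mulr1 -{1}(gtr0_norm e0) -normrM.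
  rewrite -{1}(subrK (c i * e) (power_sum b (L p) i)) addrC [e * _]mulrC.
  exact: ler_normD.
have Q : `|\sum_(i < n) c i / i`!%:R * p^-1 ^+ i| * e <= `|S| + e * r p.
  rewrite -(gtr0_norm e0) -normrM (gtr0_norm e0) mulr_suml.
  rewrite -[X in `|X| <= _](subrK S) (le_trans (ler_normD _ _)) // addrC lerD //.
  rewrite /S -sumrB (le_trans (ler_norm_sum _ _ _)) // /r mulr_sumr.
  apply: ler_sum => i _; rewrite /= rE [leRHS]mulrC divfK ?gt_eqF //.
  rewrite (_ : _ - _ = p^-1 ^+ i / i`!%:R * (c i * e - f i p)); last first.
    by rewrite /f; ring.
  rewrite normrM distrC ler_piMl // normrM normfV normr_nat normrX ger0_norm //.
  rewrite ler_pdivrMr ?ltr0n ?fact_gt0 // mul1r (le_trans (exprn_ile1 _ _ _)) //.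
  by rewrite ler1n fact_gt0.
rewrite -(ler_pM2r e0) (le_trans Q) // mulrDl mulrDl.
rewrite lerD //; last by rewrite mulrC ler_wpM2r ?(ltW e0).
rewrite (le_trans HS) //; apply: (@le_trans _ _ (p^-1 ^+ n * K * (e * (c1 + r p)))).
  by rewrite ler_wpM2l // mulr_ge0 ?exprn_ge0 ?expR_ge0.
have -> : K * (c1 + C) * p^-1 ^+ n * e = p^-1 ^+ n * K * (e * (c1 + C)) by ring.
rewrite ler_wpM2l ?mulr_ge0 ?exprn_ge0 ?expR_ge0 // ler_wpM2l ?(ltW e0) //.
by rewrite lerD2l (le_trans rp) // ler_piMr ?(ltW C0) // exprn_ile1.
Unshelve. all: by end_near. Qed.

Definition expLow (R : realType) (f : R -> R) : Prop :=
  exists2 c : R, 0 < c & exists l : R,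
    \forall p \near +oo%R, c * expR (- (l * p)) <= `|f p|.

Lemma expLow_prod (R : realType) (I : eqType) (r : seq I) (f : I -> R -> R) :
  (forall i, i \in r -> expLow (f i)) -> expLow (fun p => \prod_(i <- r) f i p).
Proof.
elim: r => [|i r IHr] fr.
  exists 1 => //; exists 0; near=> p.
  by rewrite big_nil normr1 mul0r oppr0 expR0 mulr1.
have [c c0 [l Hl]] := fr i (mem_head _ _).
have [d d0 [m Hm]] : expLow (fun p => \prod_(i <- r) f i p).
  by apply: IHr => j jr; apply: fr; rewrite in_cons jr orbT.
exists (c * d); first exact: mulr_gt0.
exists (l + m); near=> p; rewrite big_cons normrM mulrDl opprD expRD mulrACA.
by apply: ler_pM; rewrite ?mulr_ge0 ?expR_ge0 ?(ltW c0) ?(ltW d0) //; near: p.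
Unshelve. all: by end_near. Qed.

Lemma expO_small (R : realType) (l e : R) (f : R -> R) :
  0 < l -> 0 < e -> expO l f -> \forall p \near +oo%R, `|f p| <= e.
Proof.
move=> l0 e0 /(expO_inv_pow 1 l0)[C C0 HC]; near=> p.
have p0 : 0 < p by near: p; exact: nbhs_pinfty_gt.
have : `|f p| <= C * p^-1 ^+ 1 by near: p.
move=> /le_trans; apply; rewrite expr1 ler_pdivrMr // mulrC -ler_pdivrMr //.
Unshelve. all: by end_near. Qed.

(** The multiplicities of the rates are the coefficients of an exponential sum,
and these are determined by its values. *)
Lemma powsum_sub_expLow (R : realType) (s t : seq R) :
  ~~ perm_eq s t -> expLow (fun p => powsum s p - powsum t p).
Proof.
move=> st; pose w : seq (R * R) := [seq (1, r) | r <- s] ++ [seq (-1, r) | r <- t].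
have wE p : expsum w p = powsum s p - powsum t p.
  rewrite expsum_cat -powsumE; congr (_ + _).
  rewrite /expsum big_map /powsum -sumrN; apply: eq_bigr => r _.
  by rewrite mulN1r.
have wc l : rate_coef w l = (count_mem l s)%:R - (count_mem l t)%:R.
  rewrite /rate_coef big_cat !big_map /= -!sum1_count !natr_sum -sumrN.
  by congr (_ + _); apply: eq_bigl.
have [[c0 _]|[c [l [m [c0 lm H]]]]] := expsum_lead w.
  case/negP: st; apply/allP => l _ /=; rewrite -(eqr_nat R) -subr_eq0 -wc.
  exact/eqP.
have ml0 : 0 < m - l by rewrite subr_gt0.
have cc : 0 < `|c| / 2 by rewrite divr_gt0 ?normr_gt0.
have gO : expO (m - l) (fun p => (expsum w p - c * expR (- (l * p))) * expR (l * p)).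
  apply: expO_mul H _.
  by apply: expO_ext (expO_scale_exp 1 (- l)) => p; rewrite mulNr opprK mul1r.
exists (`|c| / 2) => //; exists l.
have small := expO_small ml0 cc gO; near=> p.
have : `|(expsum w p - c * expR (- (l * p))) * expR (l * p)| <= `|c| / 2 by near: p.
rewrite wE normrM; set e := expR (l * p); have e0 : 0 < e by exact: expR_gt0.
rewrite (gtr0_norm e0) -ler_pdivlMr // expRN -/e => H1.
set g := powsum s p - powsum t p in H1 *.
have : `|c / e| <= `|g - c / e| + `|g|.
  by rewrite distrC -{1}(subrK g (c / e)) ler_normD.
rewrite [`|c / e|]normrM (@gtr0_norm _ e^-1) ?invr_gt0 // => H2.
by rewrite mulrAC; lra.
Unshelve. all: by end_near. Qed.

Lemma ln_dist_ge (R : realType) (x y N : R) :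
  1 <= x <= N -> 1 <= y <= N -> `|x - y| <= N * `|ln x - ln y|.
Proof.
wlog yx : x y / y <= x => [H xN yN|/andP[x1 xN] /andP[y1 yN]].
  by have [/H|/ltW/H] := leP y x; last rewrite distrC [X in _ * X]distrC; exact.
have x0 : 0 < x by exact: lt_le_trans x1.
have y0 : 0 < y by exact: lt_le_trans y1.
rewrite !ger0_norm ?subr_ge0 ?ler_ln //.
have := expR_ge1Dx (ln y - ln x).
rewrite expRD expRN !lnK ?posrE // ler_pdivlMr // => H.
have : ln y <= ln x by rewrite ler_ln.
by move: H xN; set u := ln x; set v := ln y; nra.
Qed.

(** Evaluating [\prod_k ('X - L k)], over the [k] that are not equivalent to
[j], at all the [L k] isolates the class of [j]. The result is a combination of
the first [n] power sums, which decay faster than every exponential, whereas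
the value of the product at [L j] does not. *)
Lemma powsum_classes (R : realType) n (b : 'I_n -> R) (s : 'I_n -> seq R) :
  (forall k, all (fun r => 0 <= r) (s k)) -> (forall k, 0 \in s k) ->
  (\forall p \near +oo%R, \sum_k b k * expR (p^-1 * ln (powsum (s k) p)) = 0) ->
  forall j, \sum_(k | perm_eq (s j) (s k)) b k = 0.
Proof.
move=> s_ge0 s_0 H j; have flat := power_sum_flat s_ge0 s_0 H.
pose L p k := ln (powsum (s k) p).
pose B : R := \sum_k (size (s k))%:R.
have B0 : 0 <= B by rewrite sumr_ge0.
have sB k : (size (s k))%:R <= B by rewrite /B (bigD1 k) //= lerDl sumr_ge0.
have LB (p : R) k : 0 <= p -> `|L p k| <= B.
  by move=> p0; rewrite (le_trans (ln_powsum_bounded (s_ge0 k) (s_0 k) p0)).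
pose r := [seq k <- enum 'I_n | ~~ perm_eq (s j) (s k)].
pose q p := \prod_(a <- [seq L p k | k <- r]) ('X - a%:P).
have rn : (size r < n)%N.
  rewrite -[ltnRHS](size_enum_ord n) size_filter.
  rewrite -(count_predC (fun k => perm_eq (s j) (s k)) (enum 'I_n)).
  rewrite -[ltnLHS]add0n ltn_add2r -has_count; apply/hasP.
  by exists j; rewrite ?mem_enum.
have qE p k : (q p).[L p k] = if perm_eq (s j) (s k) then (q p).[L p j] else 0.
  case: ifPn => [jk|njk].
    by congr (_.[_]); rewrite /L /powsum (perm_big _ jk).
  by apply/rootP; rewrite root_prod_XsubC map_f // mem_filter njk mem_enum.
have qsum p : (\sum_(k | perm_eq (s j) (s k)) b k) * (q p).[L p j] =
    \sum_(i < n) (q p)`_i * power_sum b (L p) i.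
  rewrite mulr_suml big_mkcond /= (eq_bigr (fun k => b k * (q p).[L p k])); last first.
    by move=> k _; rewrite (qE p k); case: ifP; rewrite ?mulr0.
  rewrite /power_sum (eq_bigr (fun k => \sum_(i < n) (q p)`_i * (b k * L p k ^+ i))).
    by rewrite exchange_big; apply: eq_bigr => i _; rewrite mulr_sumr.
  move=> k _; rewrite (@horner_coef_wide _ n); last first.
    by rewrite size_prod_XsubC size_map.
  by rewrite mulr_sumr; apply: eq_bigr => i _; rewrite mulrCA.
have qO l : expO l (fun p => (\sum_(k | perm_eq (s j) (s k)) b k) * (q p).[L p j]).
  apply: (expO_ext (fun p => esym (qsum p))); apply: expO_sum => i _.
  rewrite -[l]add0r; apply: expO_mul; last exact: flat.
  exists ((1 + B) ^+ size r); near=> p; rewrite mul0r oppr0 expR0 mulr1.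
  rewrite -(size_map (L p)) coef_prod_XsubC_le // => _ /mapP[k _ ->].
  by apply: LB; near: p; exact: nbhs_pinfty_ge.
have [c c0 [l Hc]] : expLow (fun p => (q p).[L p j]).
  have : expLow (fun p => \prod_(k <- r) (L p j - L p k)).
    apply: expLow_prod => k; rewrite mem_filter => /andP[/powsum_sub_expLow jk _].
    have [c c0 [l Hc]] := jk; exists (c / (1 + B)).
      by rewrite divr_gt0 // ltr_pwDl.
    exists l; near=> p; have p0 : 0 <= p by near: p; exact: nbhs_pinfty_ge.
    rewrite mulrAC ler_pdivrMr ?ltr_pwDl // [leRHS]mulrC.
    have : c * expR (- (l * p)) <= `|powsum (s j) p - powsum (s k) p| by near: p.
    move=> /le_trans; apply.
    have bnd k' : 1 <= powsum (s k') p <= 1 + B.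
      rewrite powsum_ge1 // (le_trans (powsum_le_size (s_ge0 k') p0)) //.
      by rewrite (le_trans (sB k')) // lerDr.
    exact: ln_dist_ge.
  congr expLow; apply/funext => p; rewrite /q horner_prod big_map.
  by apply: eq_bigr => k _; rewrite hornerXsubC.
have [C C0 HC] := expO_pos (qO (l + 1)).
have /(expO_inv_pow 1 ltr01)[D D0 HD] : expO 1 (fun p : R => 1 * expR (- (1 * p))).
  exact: expO_scale_exp.
apply: (@le_inv_near_pinfty_eq0 _ _ (C / c * D)).
near=> p; have p0 : 0 < p by near: p; exact: nbhs_pinfty_gt.
have H1 : c * expR (- (l * p)) <= `|(q p).[L p j]| by near: p.
have : `|(\sum_(k | perm_eq (s j) (s k)) b k) * (q p).[L p j]| <=
  C * expR (- ((l + 1) * p)) by near: p.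
have : `|1 * expR (- (1 * p))| <= D * p^-1 ^+ 1 by near: p.
rewrite !mul1r expr1 ger0_norm ?expR_ge0 // normrM => H2 H3.
have e0 : 0 < c * expR (- (l * p)) by rewrite mulr_gt0 ?expR_gt0.
rewrite -(ler_pM2r e0) (le_trans (ler_wpM2l _ H1)) // (le_trans H3) //.
rewrite mulrDl opprD mul1r expRD.
have -> : C / c * D * p^-1 * (c * expR (- (l * p))) =
    C * (expR (- (l * p)) * (D * p^-1)).
  by field; rewrite ?(gt_eqF c0) ?(gt_eqF p0).
by rewrite ler_wpM2l ?(ltW C0) // ler_wpM2l // expR_ge0.
Unshelve. all: by end_near. Qed.

(** * Equivalence of vectors and absolute values of entries *)

Definition row_entries (R : realType) d (v : 'rV[R]_d) : seq R :=
  [seq v 0 i | i <- enum 'I_d].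

Definition abs_entries (R : realType) d (v : 'rV[R]_d) : seq R :=
  [seq x <- [seq `|x| | x <- row_entries v] | x != 0].

Lemma size_row_entries (R : realType) d (v : 'rV[R]_d) : size (row_entries v) = d.
Proof. by rewrite size_map size_enum_ord. Qed.

Lemma count_row_entries (R : realType) d (v : 'rV[R]_d) (P : pred R) :
  count P (row_entries v) = (\sum_(i < d) P (v 0%R i))%N.
Proof. by rewrite count_map -sum1_count big_mkcond big_enum. Qed.

Lemma perm_abs_entries (R : realType) d e (v : 'rV[R]_d) (w : 'rV[R]_e) :
  perm_eq (row_entries v) (row_entries w) ->
  perm_eq (abs_entries v) (abs_entries w).
Proof. by move=> vw; apply/perm_filter/perm_map. Qed.

Lemma row_entries_append0 (R : realType) d (v : 'rV[R]_d) :
  perm_eq (row_entries (row_mx v (0 : 'rV_1))) (0 :: row_entries v).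
Proof.
apply/seq.permP => P; rewrite /= !count_row_entries big_split_ord /= addnC.
rewrite big_ord1 row_mxEr mxE; congr (_ + _)%N.
by apply: eq_bigr => i _; rewrite row_mxEl.
Qed.

Lemma row_entries_delete (R : realType) d (v : 'rV[R]_d) (i : 'I_d) :
  perm_eq (v 0 i :: row_entries (col' i v)) (row_entries v).
Proof.
apply/seq.permP => P; rewrite /= !count_row_entries.
rewrite [RHS](bigD1_ord i) //=; congr (_ + _)%N.
by apply: eq_bigr => k _; rewrite mxE.
Qed.

Lemma row_entries_perm (R : realType) d (v : 'rV[R]_d) (s : 'S_d) :
  perm_eq (row_entries (col_perm s v)) (row_entries v).
Proof.
apply/seq.permP => P; rewrite !count_row_entries [RHS](reindex_inj (@perm_inj _ s)).
by apply: eq_bigr => k _; rewrite mxE.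
Qed.

Lemma vec_equiv_abs_entries (R : realType) d e (v : 'rV[R]_d) (w : 'rV[R]_e) :
  vec_equiv v w ->
  exists2 c : R, 0 < c & perm_eq [seq c * x | x <- abs_entries v] (abs_entries w).
Proof.
have by_perm d1 d2 (v1 : 'rV[R]_d1) (v2 : 'rV[R]_d2) :
    perm_eq (abs_entries v1) (abs_entries v2) ->
    exists2 c : R, 0 < c &
      perm_eq [seq c * x | x <- abs_entries v1] (abs_entries v2).
  by exists 1 => //; rewrite (eq_map (@mul1r R)) map_id.
elim=> {d e v w}.
- by move=> d v; apply: by_perm.
- move=> d e f u v w _ [c c0 uv] _ [c' c'0 vw]; exists (c' * c).
    exact: mulr_gt0.
  apply: perm_trans vw; rewrite (eq_map (fun x => esym (mulrA c' c x))).
  by rewrite (map_comp ( *%R c')) perm_map.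
- move=> d v; apply: by_perm; rewrite perm_sym.
  have /(perm_map Num.norm)/(perm_filter (fun x => x != 0)) := row_entries_append0 v.
  by rewrite /= normr0 eqxx.
- move=> d v i vi0; apply: by_perm; rewrite perm_sym.
  have /(perm_map Num.norm)/(perm_filter (fun x => x != 0)) := row_entries_delete v i.
  by rewrite vi0 /= normr0 eqxx.
- move=> d v s; apply: by_perm; apply: perm_abs_entries.
  by rewrite perm_sym row_entries_perm.
- move=> d v eps; apply: by_perm.
  suff nE : [seq `|x| | x <- row_entries (\row_i ((-1) ^+ eps i * v 0 i))] =
      [seq `|x| | x <- row_entries v] by rewrite /abs_entries nE.
  by rewrite /row_entries -!map_comp; apply: eq_map => i; rewrite /= mxE normrMsign.
move=> d v c c0; exists `|c|; first by rewrite normr_gt0.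
have nE : [seq `|x| | x <- row_entries (c *: v)] =
    [seq `|c| * x | x <- [seq `|x| | x <- row_entries v]].
  by rewrite /row_entries -!map_comp; apply: eq_map => i; rewrite /= mxE normrM.
rewrite /abs_entries nE [X in perm_eq _ X]filter_map.
rewrite (@eq_filter _ (preim _ _) (fun x => x != 0)) // => x /=.
by rewrite mulf_eq0 normr_eq0 (negPf c0).
Qed.

Lemma vec_equiv_perm (R : realType) d e (v : 'rV[R]_d) (w : 'rV[R]_e) :
  perm_eq (row_entries v) (row_entries w) -> vec_equiv v w.
Proof.
move=> vw; have := perm_size vw; rewrite !size_row_entries => de.
case: e / de w vw => w; rewrite perm_sym => vw.
have /tuple_permP[s sE] : perm_eq (row_entries w) [tuple v 0 i | i < d] by [].
suff -> : w = col_perm s v by exact: ve_perm.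
apply/rowP => i; rewrite mxE.
have := congr1 (fun r => nth 0 r i) sE.
rewrite /row_entries (nth_map i) ?size_enum_ord // nth_ord_enum => ->.
by rewrite (nth_map i) ?size_enum_ord // nth_ord_enum tnth_mktuple.
Qed.

Definition row_of_seq (R : realType) (s : seq R) : 'rV[R]_(size s) :=
  \row_i nth 0 s i.

Lemma row_of_seqK (R : realType) (s : seq R) :
  perm_eq (row_entries (row_of_seq s)) s.
Proof.
apply/seq.permP => P; rewrite count_row_entries -sum1_count [RHS]big_mkcond.
rewrite (big_nth 0) big_mkord; apply: eq_bigr => i _.
by rewrite mxE; case: (P _).
Qed.

Lemma vec_equiv_row_of_seq (R : realType) (s t : seq R) :
  perm_eq s t -> vec_equiv (row_of_seq s) (row_of_seq t).
Proof.
move=> st; apply: vec_equiv_perm; apply: perm_trans (row_of_seqK s) _.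
by rewrite perm_sym (perm_trans (row_of_seqK t)) // perm_sym.
Qed.

Lemma vec_equiv_append0 (R : realType) (s : seq R) m :
  vec_equiv (row_of_seq s) (row_of_seq (nseq m 0 ++ s)).
Proof.
elim: m => [|m IHm]; first exact: ve_refl.
apply: ve_trans IHm _; apply: ve_trans (ve_append _) (vec_equiv_perm _).
apply: perm_trans (row_entries_append0 _) _.
by rewrite perm_sym (perm_trans (row_of_seqK _)) //= perm_cons perm_sym row_of_seqK.
Qed.

Lemma vec_equiv_delete0 (R : realType) (s : seq R) m :
  vec_equiv (row_of_seq (nseq m 0 ++ s)) (row_of_seq s).
Proof.
elim: m => [|m IHm]; first exact: ve_refl.
apply: ve_trans IHm.
have z : row_of_seq (nseq m.+1 0 ++ s) 0 ord0 = 0 by rewrite mxE.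
apply: ve_trans (ve_delete z) (vec_equiv_perm _).
have := row_entries_delete (row_of_seq (nseq m.+1 0 ++ s)) ord0.
rewrite z => /perm_trans/(_ (row_of_seqK _)); rewrite /= perm_cons => H.
by rewrite (perm_trans H) // perm_sym row_of_seqK.
Qed.

Lemma vec_equiv_norm (R : realType) d (v : 'rV[R]_d) :
  vec_equiv v (\row_i `|v 0 i|) /\ vec_equiv (\row_i `|v 0 i|) v.
Proof.
split; have := ve_sign _ (fun i => v 0 i < 0).
  move=> /(_ _ v); congr vec_equiv; apply/rowP => i; rewrite !mxE.
  by rewrite -normrEsign.
move=> /(_ _ (\row_i `|v 0 i|)); congr vec_equiv; apply/rowP => i; rewrite !mxE.
by rewrite -numEsign.
Qed.

(** Every vector can be taken to its nonzero absolute values and back: changing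
signs and permuting undo themselves, and [ve_append] undoes [ve_delete]. *)
Lemma vec_equiv_normal_form (R : realType) d (v : 'rV[R]_d) :
  vec_equiv v (row_of_seq (abs_entries v)) /\
  vec_equiv (row_of_seq (abs_entries v)) v.
Proof.
have [vn nv] := vec_equiv_norm v.
set s := [seq `|x| | x <- row_entries v].
have ns : row_entries (\row_i `|v 0 i|) = s.
  by rewrite /s /row_entries -[RHS]map_comp; apply: eq_map => i; rewrite mxE.
pose m := size [seq x <- s | x == 0].
have sm : perm_eq s (nseq m 0 ++ abs_entries v).
  rewrite -(perm_filterC (pred1 0) s) perm_cat //.
  by have /all_pred1P -> := filter_all (pred1 0) s.
have ps : perm_eq (row_entries (\row_i `|v 0 i|))
    (row_entries (row_of_seq (nseq m 0 ++ abs_entries v))).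
  by rewrite ns (perm_trans sm) // perm_sym row_of_seqK.
split.
  apply: ve_trans vn _; apply: ve_trans (vec_equiv_delete0 _ m).
  exact: vec_equiv_perm.
apply: ve_trans nv; apply: ve_trans (vec_equiv_append0 _ m) _.
by apply: vec_equiv_perm; rewrite perm_sym.
Qed.

Lemma abs_entries_vec_equiv (R : realType) d e (v : 'rV[R]_d) (w : 'rV[R]_e) (c : R) :
  c != 0 -> perm_eq [seq c * x | x <- abs_entries v] (abs_entries w) ->
  vec_equiv v w.
Proof.
move=> c0 vw; apply: ve_trans (vec_equiv_normal_form v).1 _.
apply: ve_trans (vec_equiv_normal_form w).2.
apply: ve_trans (ve_scale _ c0) _.
apply: ve_trans (vec_equiv_row_of_seq vw); apply: vec_equiv_perm.
apply: perm_trans (_ : perm_eq _ [seq c * x | x <- abs_entries v]) _.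
  rewrite (_ : row_entries _ =
    [seq c * x | x <- row_entries (row_of_seq (abs_entries v))]).
    by rewrite perm_map // row_of_seqK.
  by rewrite /row_entries -[RHS]map_comp; apply: eq_map => i; rewrite /= mxE.
by rewrite perm_sym row_of_seqK.
Qed.

(** * Norms of vectors *)

Local Arguments pnorm : simpl never.

(** The logarithms of the inverses of the nonzero absolute values, once these
are scaled to have maximum [1]; as a multiset, this is a complete invariant of
the equivalence of nonzero vectors. *)
Definition rates (R : realType) d (v : 'rV[R]_d) : seq R :=
  [seq ln (pnorm +oo%E v) - ln x | x <- abs_entries v].

Lemma abs_entries_gt0 (R : realType) d (v : 'rV[R]_d) x :
  x \in abs_entries v -> 0 < x.
Proof.
by rewrite mem_filter => /andP[x0 /mapP[y _ xy]]; rewrite lt_neqAle eq_sym x0 xy /=.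
Qed.

Lemma abs_entries_le (R : realType) d (v : 'rV[R]_d) x :
  x \in abs_entries v -> x <= pnorm +oo%E v.
Proof.
rewrite mem_filter => /andP[_ /mapP[_ /mapP[i _ ->] ->]].
by apply: (le_bigmax_seq 0 _ xpredT (fun i => `|v 0 i|)); rewrite ?mem_index_enum.
Qed.

Lemma pnorm_oo_abs_entries (R : realType) d (v : 'rV[R]_d) :
  v != 0 -> pnorm +oo%E v \in abs_entries v.
Proof.
move=> v0; have [j vj] : exists j, v 0 j != 0.
  by apply/existsP; apply: contraNT v0; rewrite negb_exists => /forallP H;
     apply/eqP/rowP => j; rewrite mxE; apply/eqP; rewrite -[_ == _]negbK.
have [//|//|i _ E] := @eq_bigmax _ _ _ 0 j xpredT (fun i => `|v 0 i|).
rewrite /abs_entries mem_filter; apply/andP; split.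
  rewrite gt_eqF //; apply: (@lt_le_trans _ _ `|v 0 j|); first by rewrite normr_gt0.
  by apply: (le_bigmax_seq 0 _ xpredT (fun i => `|v 0 i|)); rewrite ?mem_index_enum.
by rewrite /pnorm E !map_f // mem_enum.
Qed.

Lemma rates_ge0 (R : realType) d (v : 'rV[R]_d) :
  all (fun r => 0 <= r) (rates v).
Proof.
apply/allP => _ /mapP[x xv ->]; have x0 := abs_entries_gt0 xv.
by rewrite subr_ge0 ler_ln ?posrE ?abs_entries_le // (lt_le_trans x0) // abs_entries_le.
Qed.

Lemma rates_0 (R : realType) d (v : 'rV[R]_d) : v != 0 -> 0 \in rates v.
Proof.
by move=> /pnorm_oo_abs_entries v1; apply/mapP; exists (pnorm +oo%E v); rewrite ?subrr.
Qed.

Lemma pnorm_powsum (R : realType) d (v : 'rV[R]_d) (p : R) :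
  v != 0 -> 0 < p ->
  pnorm p%:E v = pnorm +oo%E v * expR (p^-1 * ln (powsum (rates v) p)).
Proof.
move=> v0 p0; have v1 := pnorm_oo_abs_entries v0; have l0 := abs_entries_gt0 v1.
have P0 : 0 < powsum (rates v) p.
  by apply: lt_le_trans (powsum_ge1 p (rates_0 v0)).
rewrite /pnorm -/(pnorm +oo%E v); set l := pnorm +oo%E v in l0 *.
have -> : \sum_i `|v 0 i| `^ p = expR (p * ln l) * powsum (rates v) p.
  transitivity (\sum_(x <- abs_entries v) x `^ p).
    rewrite /abs_entries big_filter 2!big_map big_enum_cond /=.
    rewrite [LHS](bigID (fun i => `|v 0 i| != 0)) /=.
    rewrite [X in _ + X]big1 ?addr0 // => i /negPn/eqP ->.
    by rewrite powR0 // gt_eqF.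
  rewrite /powsum big_map mulr_sumr [LHS]big_seq [RHS]big_seq.
  apply: eq_bigr => x /abs_entries_gt0 x0.
  by rewrite /powR gt_eqF // -expRD -/l; congr expR; ring.
rewrite {1}/powR gt_eqF ?mulr_gt0 ?expR_gt0 // lnM ?posrE ?expR_gt0 // expRK.
rewrite mulrDr expRD mulrA mulVf ?gt_eqF // mul1r lnK //.
Qed.

Lemma vec_equiv_rates (R : realType) d e (v : 'rV[R]_d) (w : 'rV[R]_e) :
  v != 0 -> w != 0 -> vec_equiv v w <-> perm_eq (rates v) (rates w).
Proof.
move=> v0 w0; have v1 := pnorm_oo_abs_entries v0; have w1 := pnorm_oo_abs_entries w0.
have lv := abs_entries_gt0 v1; have lw := abs_entries_gt0 w1.
split=> [/vec_equiv_abs_entries[c c0 vw]|vw].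
  have lE : pnorm +oo%E w = c * pnorm +oo%E v.
    apply/le_anti/andP; split.
      have := w1; rewrite -(perm_mem vw) => /mapP[x xv ->].
      by rewrite ler_pM2l // abs_entries_le.
    by apply: abs_entries_le; rewrite -(perm_mem vw) map_f.
  have := perm_map (fun x => ln (pnorm +oo%E w) - ln x) vw; rewrite -map_comp.
  congr (perm_eq _ _); apply/eq_in_map => x xv /=.
  have x0 := abs_entries_gt0 xv.
  by rewrite lE !lnM ?posrE // opprD addrACA subrr add0r.
apply: (@abs_entries_vec_equiv _ _ _ _ _ (pnorm +oo%E w / pnorm +oo%E v)).
  by rewrite gt_eqF // divr_gt0.
have := perm_map (fun r => pnorm +oo%E w * expR (- r)) vw; rewrite -!map_comp.
have E d' (u : 'rV[R]_d') : 0 < pnorm +oo%E u ->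
    [seq ((fun r => pnorm +oo%E w * expR (- r)) \o
         (fun x => ln (pnorm +oo%E u) - ln x)) i | i <- abs_entries u] =
    [seq pnorm +oo%E w / pnorm +oo%E u * x | x <- abs_entries u].
  move=> lu; apply/eq_in_map => x xu /=; have x0 := abs_entries_gt0 xu.
  by rewrite opprB expRD expRN !lnK ?posrE // mulrA mulrAC.
rewrite (E _ v lv) (E _ w lw) divff ?gt_eqF //.
by rewrite (eq_map (@mul1r R)) map_id.
Qed.

Lemma analytic_powsum_root (R : realType) (s : seq R) : 0 \in s ->
  analytic_pos (fun p => expR (p^-1 * ln (powsum s p))).
Proof.
move=> s0; apply: analytic_expR; apply: analytic_mul.
  by apply: analytic_inv (analytic_id R) => x x0; rewrite gt_eqF.
apply: analytic_ln => [p _|]; first exact: lt_le_trans (powsum_ge1 p s0).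
apply: analytic_sum => r; apply: analytic_expR.
apply: analytic_ext (analytic_mul (analytic_cst (- r)) (analytic_id R)).
by move=> x _; rewrite mulNr.
Qed.

Theorem theorem1 (R : realType) (n : nat) (hn : (1 <= n)%N)
  (d : 'I_n -> nat) (hd : forall k, (0 < d k)%N)
  (v : forall k, 'rV[R]_(d k)) (hv : forall k, v k != 0)
  (alpha : 'I_n -> R)
  (a b : \bar R) (ha : (1 <= a)%E) (hab : (a < b)%E)
  (hsum : forall p : \bar R, (a <= p <= b)%E ->
    \sum_(k < n) alpha k * pnorm p (v k) = 0)
  (C : {set 'I_n})
  (hC : C \in equivalence_partition (vec_equivb v) [set: 'I_n])
  (p : \bar R) (hp : (a <= p <= b)%E) :
  \sum_(k in C) alpha k * pnorm p (v k) = 0.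
Proof.
have [a1 aE] : exists a1, a = a1%:E.
  case: a ha hab {hsum hp} => [a1 _ _|_|]; [by exists a1| |by []].
  by rewrite ltNge leey.
have [b1 a1b1 b1b] : exists2 b1, a1 < b1 & (b1%:E <= b)%E.
  move: hab; rewrite aE; case: b {hsum hp} => [b1|_|]; last by [].
    by rewrite lte_fin => ab; exists b1.
  by exists (a1 + 1); rewrite ?ltrDl ?leey.
have a10 : 0 < a1 by rewrite (@lt_le_trans _ _ 1) // -lee_fin -aE.
pose s k := rates (v k); pose g k := alpha k * pnorm +oo%E (v k).
have s0 k : 0 \in s k by exact: rates_0.
have s_ge0 k : all (fun r => 0 <= r) (s k) by exact: rates_ge0.
have core j : \sum_(k | perm_eq (s j) (s k)) g k = 0.
  apply: (powsum_classes s_ge0 s0).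
  near=> q.
  have qa : a1 <= q by near: q; apply: nbhs_pinfty_ge; exact: num_real.
  pose f x := \sum_k g k * expR (x^-1 * ln (powsum (s k) x)).
  apply: (@analytic_identity _ f _ _ _ a10 a1b1 _ q qa).
    apply: analytic_sum => k; apply: analytic_mul (analytic_cst _) _.
    exact: analytic_powsum_root.
  move=> x /andP[ax xb]; have x0 : 0 < x by exact: lt_le_trans ax.
  rewrite -(hsum x%:E); last by rewrite aE lee_fin ax (le_trans _ b1b).
  by apply: eq_bigr => k _; rewrite pnorm_powsum // mulrA.
have /imsetP[j _ ->] := hC.
have jE k : (k \in [set y in [set: 'I_n] | vec_equivb v j y]) =
    perm_eq (s j) (s k).
  by rewrite !inE /=; apply/asboolP/idP => /(vec_equiv_rates (hv j) (hv k)).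
rewrite (eq_bigl _ _ jE).
move: hp; rewrite aE; case: p => [p||] /andP[ap pb]; last by [].
  have p0 : 0 < p by rewrite (lt_le_trans a10).
  rewrite (eq_bigr (fun k => g k * expR (p^-1 * ln (powsum (s j) p)))).
    by rewrite -mulr_suml core mul0r.
  move=> k jk; rewrite pnorm_powsum // mulrA; congr (_ * expR (_ * ln _)).
  by rewrite /powsum -(perm_big _ jk).
by rewrite -[RHS](core j); apply: eq_bigr.
Unshelve. all: by end_near. Qed.
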